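(* Let $(Q,W)$ be the quiver with potential associated to a geometrically consistent brane tiling with bipartite graph $G$, let $A=\mathbb{C}Q/(\partial W)$, $\alpha=(1,\dots,1)\in\mathbb{Z}^{Q_0}$, let $\theta\in B$ be $\alpha$-generic, and let $\mathcal{M}_\theta=\mathcal{M}_\theta(A,\alpha)$. Let $x\in\mathcal{M}_\theta$ and let $O_x\subset\mathcal{M}_\theta$ be its $T_M$-orbit. Then 1. $\dim O_x=3$ if and only if the cosupport $I_x$ is empty. 2. $\dim O_x=2$ if and only if $I_x$ is a perfect matching. 3. $\dim O_x=1$ if and only if the big component of $I_x$ is a cycle. 4. $\dim O_x=0$ if and only if the big component of $I_x$ has two trivalent vertices of different colors and all its other vertices have valence $2$.
   Context: Brane tilings. A brane tiling is a bipartite graph $G=(G_0^\pm,G_1)$ (white vertices $G_0^+$, black vertices $G_0^-$) embedded in the real two-dimensional torus $T$ so that all connected components of $T\setminus G$ are simply connected; the set of these faces is $G_2$. The dual quiver $Q=(Q_0,Q_1)$ has $Q_0=G_2$ and $Q_1=G_1$; the arrow $a$ joins the two faces of $G$ adjacent to the edge $a$ and is directed so that the white endpoint lies on the right of $a$. $Q$ is embedded in $T$ and its set of faces $Q_2$ is identified with $G_0$, $Q_2=Q_2^+\sqcup Q_2^-$. The arrows around every face $F\in Q_2$ form an oriented cycle $w_F$. Put $W=\sum_{F\in Q_2^+}w_F-\sum_{F\in Q_2^-}w_F$; for a cycle $u=a_1\cdots a_n$, $\partial u/\partial a=\sum_{i:\,a_i=a}a_{i+1}\cdots a_na_1\cdots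 a_{i-1}$; $(\partial W)$ is the two-sided ideal generated by all $\partial W/\partial a$, and $A=\mathbb{C}Q/(\partial W)$. Geometric consistency: there is a map $R:Q_1\to(0,1)$ with $\sum_{a\in F}R_a=2$ for all $F\in Q_2$ and $\sum_{a\ni i}(1-R_a)=2$ for all $i\in Q_0$ (sum over arrows incident to $i$, loops counted twice). Groups. $d_2(F)=\sum_{a\in F}a\in\mathbb{Z}^{Q_1}$ for $F\in Q_2$, $d_1(a)=t(a)-s(a)\in\mathbb{Z}^{Q_0}$ for $a\in Q_1$, $\Lambda=\mathbb{Z}^{Q_1}/\langle d_2(F)-d_2(F')\mid F,F'\in Q_2\rangle$, $d:\Lambda\to\mathbb{Z}^{Q_0}$ is induced by $d_1$, $M=\ker d$ (free of rank 3), $B=\ker(\mathbb{Z}^{Q_0}\to\mathbb{Z},\ i\mapsto1)=\operatorname{im}d$. For a lattice $L$ put $T_L=\operatorname{Hom}_{\mathbb{Z}}(L,\mathbb{C}^* )$; $T_M=T_\Lambda/T_B$. Moduli. $R(A,\alpha)\subset\mathbb{C}^{Q_1}$ is the variety of representations $x=(x_a)_{a\in Q_1}$ of $Q$ of dimension $\alpha$ satisfying the relations of $W$; $T_\Lambda\subset(\mathbb{C}^* )^{Q_1}$ acts on it by coordinatewise multiplication, and $T_B$ acts via $d$, i.e. by change of basis. $\theta\in B$ is $\alpha$-generic if $\theta\cdot\beta\ne0$ for all $0<\beta<\alpha$ in $\mathbb{Z}^{Q_0}$. $X\in R(A,\alpha)$ is $\theta$-semistable (resp. stable) if $\theta\cdot\dim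 Y\ge0$ (resp. $>0$) for all proper nonzero subrepresentations $Y\subset X$; for $\alpha$-generic $\theta$ these notions agree. $\mathcal{M}_\theta=R(A,\alpha)/\!/_\theta T_B$ is the moduli space of $\theta$-semistable left $A$-modules of dimension $\alpha$; it carries an action of the three-dimensional torus $T_M$. Cosupports. For a point $x$ of $\mathcal{M}_\theta$ (a class of representations $(x_a)$ up to isomorphism) its cosupport is $I_x=\{a\in Q_1\mid x_a=0\}$, regarded as a subgraph of $G$ via $Q_1=G_1$. A connected component of $I_x$ is called big if it has more than one edge; the cosupport of an indecomposable $A$-module of dimension $\alpha$ has at most one big component. In 3 and 4 the statement includes that a big component exists. A perfect matching is a set of edges of $G$ such that every vertex of $G$ is incident with exactly one of them. *)

(* Defs.v *)
From mathcomp Require Import all_boot all_order all_fingroup all_algebra.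
From mathcomp Require Import boolp classical_sets reals.
From mathcomp Require Import complex mpoly.

Set Implicit Arguments.
Unset Strict Implicit.
Unset Printing Implicit Defensive.

Import Order.TTheory GRing.Theory Num.Theory.

Local Open Scope classical_set_scope.
Local Open Scope ring_scope.

(* A bipartite graph (multiple edges allowed) embedded in an oriented closed
   connected surface with simply connected faces is encoded by its rotation
   system.  [nextw a] is the edge following [a] clockwise around the white
   endpoint of [a], and [nextb a] is the edge following [a] counterclockwise
   around its black endpoint.  White vertices, black vertices and faces are then
   the cycles of [nextw], of [nextb] and of [nextw^-1 * nextb].  Since faces of
   a nonempty connected rotation system are discs, the surface is the torus
   exactly when the Euler characteristic V - E + F is 0. *)
Record brane_tiling := BraneTiling {
  edge : finType;
  nextw : {perm edge};
  nextb : {perm edge};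
  tiling_nonempty : (0 < #|edge|)%N;
  tiling_connected : forall a b : edge,
    connect [rel c d | (d == nextw c) || (d == nextb c)] a b;
  tiling_euler :
    (#|porbits nextw| + #|porbits nextb| + #|porbits (nextw^-1 * nextb)%g|
     = #|edge|)%N
}.

Section Quiver.
Variable G : brane_tiling.

Definition white := {F : {set edge G} | F \in porbits (nextw G)}.
Definition black := {F : {set edge G} | F \in porbits (nextb G)}.

(* Vertices of G, i.e. the set Q_2 of faces of Q, with Q_2^+ on the left. *)
Definition vert := (white + black)%type.

(* Faces of G. *)
Definition Q0 := {i : {set edge G} | i \in porbits ((nextw G)^-1 * nextb G)%g}.

Definition white_of (a : edge G) : white :=
  Sub (porbit (nextw G) a) (imset_f _ isT).
Definition black_of (a : edge G) : black :=
  Sub (porbit (nextb G) a) (imset_f _ isT).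

Definition edges_at (F : vert) : {set edge G} :=
  match F with inl w => val w | inr b => val b end.

(* The white endpoint of [a] lies on the right of [a], so the oriented cycle of
   arrows around a white (black) vertex runs clockwise (counterclockwise), and
   the head of [a] is the common tail of [nextw a] and [nextb a].  Hence the
   arrows with a given tail form a cycle of [nextw^-1 * nextb]. *)
Definition src (a : edge G) : Q0 :=
  Sub (porbit ((nextw G)^-1 * nextb G)%g a) (imset_f _ isT).
Definition tgt (a : edge G) : Q0 := src (nextw G a).

(* The cyclic word w_F, its arrows listed in the order of travel from an arbitrary
   arrow of F on.  Cyclic derivatives do not depend on the starting arrow, and the
   opposite order of composition would give the same relations in dimension
   (1, ..., 1), where all arrows act by scalars. *)
Definition cycle_word (p : {perm edge G}) (F : {set edge G}) : seq (edge G) :=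
  if [pick a in F] is Some a then fingraph.orbit p a else [::].

Definition potential : seq (int * seq (edge G)) :=
  [seq (1%:Z, cycle_word (nextw G) (val F)) | F : white]
  ++ [seq (- 1%:Z, cycle_word (nextb G) (val F)) | F : black].

Definition word_deriv (a : edge G) (u : seq (edge G)) : seq (seq (edge G)) :=
  [seq behead (rot k u) | k <- iota 0 (size u) & nth a u k == a].

Definition cyclic_deriv (a : edge G) (U : seq (int * seq (edge G))) :=
  [seq (cu.1, v) | cu <- U, v <- word_deriv a cu.2].

Definition d2 (F : vert) : {ffun edge G -> int} :=
  [ffun a => (a \in edges_at F)%:R].
Definition d1 (a : edge G) : {ffun Q0 -> int} :=
  [ffun i => (i == tgt a)%:R - (i == src a)%:R].

Definition geometrically_consistent (R : realType) : Prop :=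
  exists r : edge G -> R,
    [/\ forall a, 0 < r a < 1,
        forall F : vert, \sum_(a in edges_at F) r a = 2 &
        forall i : Q0, \sum_(a | src a == i) (1 - r a)
                       + \sum_(a | tgt a == i) (1 - r a) = 2].

Definition in_B (theta : {ffun Q0 -> int}) : Prop := \sum_i theta i = 0.

Definition dot (theta beta : {ffun Q0 -> int}) : int :=
  \sum_i theta i * beta i.

Definition alpha : {ffun Q0 -> int} := [ffun=> 1].

Definition generic (theta : {ffun Q0 -> int}) : Prop :=
  forall beta : {ffun Q0 -> int},
    (forall i, 0 <= beta i <= alpha i) -> beta <> [ffun=> 0] -> beta <> alpha ->
    dot theta beta <> 0.

Definition perfect_matching (I : {set edge G}) : Prop :=
  forall F : vert, #|I :&: edges_at F|%SET = 1%N.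

Definition share_vertex (a b : edge G) : bool :=
  (white_of a == white_of b) || (black_of a == black_of b).

(* Connected components having at least one edge, given by their edge sets. *)
Definition component (I C : {set edge G}) : Prop :=
  exists2 a, a \in I &
    C = finset (connect [rel b c | [&& b \in I, c \in I & share_vertex b c]] a).

Definition big_component (I C : {set edge G}) : Prop :=
  component I C /\ (1 < #|C|)%N.

(* A closed walk e_1 f_1 e_2 f_2 ... e_n f_n with n >= 1 and no repeated edge or
   vertex, where e_i and f_i meet at a white vertex, and f_i and e_(i+1) at a
   black one.  The value n = 1 is a pair of parallel edges. *)
Definition is_cycle (C : {set edge G}) : Prop :=
  exists p : seq (edge G * edge G),
    let es := [seq u.1 | u <- p] ++ [seq u.2 | u <- p] in
    [/\ p != [::],
        all (fun u => white_of u.1 == white_of u.2) p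
          && path.cycle (fun u v => black_of u.2 == black_of v.1) p,
        uniq [seq white_of u.1 | u <- p] && uniq [seq black_of u.2 | u <- p],
        uniq es &
        C =i es].

Definition valence (C : {set edge G}) (F : vert) : nat :=
  #|C :&: edges_at F|%SET.

Definition two_trivalent (C : {set edge G}) : Prop :=
  exists (w : white) (b : black),
    [/\ valence C (inl w) = 3%N, valence C (inr b) = 3%N &
        forall F : vert, F <> inl w -> F <> inr b ->
          (0 < valence C F)%N -> valence C F = 2%N].

End Quiver.

(* A topology on a subset of T is given by its family [cl] of closed sets. *)
Section KrullDimension.
Variables (T : Type) (cl : set (set T)).

Definition induced (O : set T) : set (set T) := [set O `&` Z | Z in cl].

Definition irreducible (Z : set T) : Prop :=
  Z !=set0 /\
  forall A B, cl A -> cl B -> Z `<=` A `|` B -> Z `<=` A \/ Z `<=` B.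

Definition irred_chain (n : nat) : Prop :=
  exists Z : nat -> set T,
    (forall i, (i <= n)%N -> cl (Z i) /\ irreducible (Z i)) /\
    (forall i, (i < n)%N -> Z i `<` Z i.+1).

Definition krull_dim (n : nat) : Prop :=
  irred_chain n /\ forall m, irred_chain m -> (m <= n)%N.

End KrullDimension.

Section Moduli.
Variables (R : realType) (G : brane_tiling).
Local Notation C := R[i].
Local Notation point := {ffun edge G -> C}.

Definition word_val (x : point) (u : seq (edge G)) : C := \prod_(a <- u) x a.

Definition satisfies_relations (x : point) : Prop :=
  forall a, \sum_(cu <- cyclic_deriv a (potential G))
              cu.1%:~R * word_val x cu.2 = 0.

Definition subrep (x : point) (Y : Q0 G -> {vspace C^o}) : Prop :=
  forall (a : edge G) (v : C^o), v \in Y (src a) -> x a *: v \in Y (tgt a).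

Definition dimv (Y : Q0 G -> {vspace C^o}) : {ffun Q0 G -> int} :=
  [ffun i => (\dim (Y i))%:Z].

(* The theta-semistable points of R(A, alpha). *)
Definition semistable (theta : {ffun Q0 G -> int}) (x : point) : Prop :=
  satisfies_relations x /\
  forall Y : Q0 G -> {vspace C^o}, subrep x Y ->
    (exists i, Y i <> 0%VS) -> (exists i, Y i <> fullv) ->
    0 <= dot theta (dimv Y).

(* The value at v of the character of Z^J with coordinates t. *)
Definition character (J : finType) (t : {ffun J -> C}) (v : {ffun J -> int}) : C :=
  \prod_j t j ^ v j.

Definition torus (J : finType) : set {ffun J -> C} :=
  [set t | forall j, t j != 0].

Definition T_Lambda : set point :=
  [set t | torus t /\ forall F F' : vert G, character t (d2 F - d2 F') = 1].

Definition act (t x : point) : point := [ffun a => t a * x a].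

(* As Z^(Q_0) / B is free, every character of B extends to Z^(Q_0), so the orbits
   of T_B are those of the torus Hom(Z^(Q_0), C^* ), acting via d_1. *)
Definition iso_class (x : point) : set point :=
  [set act [ffun a => character g (d1 a)] x | g in torus (J := Q0 G)].

(* For generic theta the GIT quotient is geometric: its points are the T_B-orbits
   of semistable points, and its Zariski topology is the quotient topology. *)
Definition moduli (theta : {ffun Q0 G -> int}) : set (set point) :=
  [set iso_class x | x in semistable theta].

Definition zariski_closed (V : set point) : Prop :=
  exists S : set {mpoly C[#|edge G|]},
    V = [set x : point | forall p, S p -> p.@[fun k => x (enum_val k)] = 0].

Definition moduli_closed (theta : {ffun Q0 G -> int}) : set (set (set point)) :=
  [set Z | Z `<=` moduli theta /\
     exists2 V, zariski_closed V &
       forall x, semistable theta x -> (Z (iso_class x) <-> V x)].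

(* T_M = T_Lambda / T_B. *)
Definition T_M_orbit (x : point) : set (set point) :=
  [set iso_class (act t x) | t in T_Lambda].

Definition T_M_orbit_dim (theta : {ffun Q0 G -> int}) (x : point) (n : nat) :=
  krull_dim (induced (moduli_closed theta) (T_M_orbit x)) n.

Definition cosupport (x : point) : {set edge G} := finset (fun a => x a == 0).

End Moduli.

(* Main.v *)
(* The orbit O_x is the quotient of tori T_Lambda x / T_B x.  Its Krull dimension
   is a difference of ranks of cocharacter lattices: one-parameter subgroups give
   a chain of that length, and a longer chain would produce too many linearly
   independent monomials in the functions separating its members.  With I the
   cosupport, this gives dim O_x = 3 - s, where s is the dimension of the space of
   rational edge weights supported on I that have equal sums at all vertices of G.
   The relations force every vertex of G to meet I as soon as I is nonempty, and
   force all valences in a big component to be at least 2; genericity of theta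
   says that I does not disconnect the torus.  Hence weights on I with vanishing
   vertex sums inject into the first homology of the torus, and two big components
   would carry vertex-disjoint, so homologically dependent, cycles.  If J is the
   big component then s = 2 + b, where b is the sum of (valence - 2) over the white
   (equivalently, the black) vertices of J, and s = 1 if I is a perfect matching. *)
From mathcomp Require Import boolp classical_sets.
From mathcomp Require Import all_boot all_order all_fingroup all_algebra.
From mathcomp Require Import reals complex mpoly ring zify.
Require Import Defs.

Set Implicit Arguments.
Unset Strict Implicit.
Unset Printing Implicit Defensive.

Import Order.TTheory GRing.Theory Num.Theory.

Local Open Scope ring_scope.

(** * Irreducibility of tori *)

(** The obstacle is that the Krull dimension has to be computed from its definition, on a quotient
    whose points are isomorphism classes. Polynomials live on the representation space and are not
    gauge invariant. Closed sets are therefore cut out either by binomials of characters that are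
    trivial on the gauge group, which separate the members of a chain, or by all gauge translates of
    one polynomial, which test irreducibility. For the upper bound the quotient is avoided
    altogether: a chain is lifted to [T_Lambda x], lengthened by the gauge rank [h], and compared
    with the rank [h + e] of the torus that acts effectively. Characters and cocharacters come from
    linear algebra over the rationals. After clearing denominators they are dual only up to nonzero
    integers [D], and generate the coordinates only up to an [N0]-th power. Neither defect affects a
    dimension, so no splitting of lattices is required. Geometric consistency enters through the
    equality of the numbers of white and black vertices. Homology is handled by ranks of matrices
    and by an intersection form on edge weights, defined through primitives around the vertices. *)

Section LocalizedPolynomials.
Variables (F : numFieldType) (L : {poly F}).

(* [f] is a function in F[z][1/L]. *)
Definition localized (f : F -> F) : Prop :=
  exists P M, forall z, L.[z] != 0 -> P.[z] = L.[z] ^+ M * f z.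

Lemma localized_cst c : localized (fun=> c).
Proof. by exists c%:P, 0 => z _; rewrite hornerC mul1r. Qed.

Lemma localizedD f g : localized f -> localized g ->
  localized (fun z => f z + g z).
Proof.
move=> [P [M fP]] [Q [N gQ]].
exists (P * L ^+ N + Q * L ^+ M), (M + N)%N => z Lz.
rewrite hornerD !hornerM !horner_exp fP // gQ // exprD mulrDr.
by congr (_ + _); [exact: mulrAC | rewrite mulrAC [L.[z] ^+ N * _]mulrC].
Qed.

Lemma localizedM f g : localized f -> localized g ->
  localized (fun z => f z * g z).
Proof.
move=> [P [M fP]] [Q [N gQ]].
exists (P * Q), (M + N)%N => z Lz.
by rewrite hornerM fP // gQ // exprD mulrACA.
Qed.

Lemma localizedX f n : localized f -> localized (fun z => f z ^+ n).
Proof.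
move=> lf; elim: n => [|n IHn]; first exact: localized_cst.
have [P [M PE]] := localizedM lf IHn.
by exists P, M => z Lz; rewrite PE // exprS.
Qed.

Lemma localized_prod (I : Type) (r : seq I) (f : I -> F -> F) :
  (forall i, localized (f i)) -> localized (fun z => \prod_(i <- r) f i z).
Proof.
move=> lf; elim: r => [|i r IHr].
  by exists 1, 0 => z _; rewrite big_nil hornerC mul1r.
have [P [M PE]] := localizedM (lf i) IHr.
by exists P, M => z Lz; rewrite PE // big_cons.
Qed.

Lemma localized_sum (I : Type) (r : seq I) (f : I -> F -> F) :
  (forall i, localized (f i)) -> localized (fun z => \sum_(i <- r) f i z).
Proof.
move=> lf; elim: r => [|i r IHr].
  by exists 0, 0 => z _; rewrite big_nil hornerC mulr0.
have [P [M PE]] := localizedD (lf i) IHr.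
by exists P, M => z Lz; rewrite PE // big_cons.
Qed.

Lemma localized_meval n (p : {mpoly F[n]}) (v : F -> 'I_n -> F) :
  (forall i, localized (v^~ i)) -> localized (fun z => p.@[v z]).
Proof.
move=> lv; have: localized (fun z => \sum_(m <- msupp p)
    p@_m * \prod_i v z i ^+ m i).
  apply: localized_sum => m; apply: localizedM; first exact: localized_cst.
  by apply: localized_prod => i; apply: localizedX.
by case=> P [M PE]; exists P, M => z Lz; rewrite PE // mevalE.
Qed.

End LocalizedPolynomials.

Lemma poly_vanishing (F : numFieldType) (p : {poly F}) :
  (forall z, p.[z] = 0) -> p = 0.
Proof.
move=> p0; apply/eqP; apply: contraT => pN0.
have /(max_poly_roots pN0) :
  all (root p) [seq i%:R : F | i <- iota 0 (size p)].
  by apply/allP=> z _; apply/rootP.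
rewrite map_inj_uniq; last by move=> i j /eqP; rewrite eqr_nat => /eqP.
by rewrite iota_uniq size_map size_iota ltnn => /(_ isT).
Qed.

Section Torus.
Variable R : realType.
Local Notation C := R[i].

Lemma character_neq0 (J : finType) (t : {ffun J -> C}) v :
  torus t -> character t v != 0.
Proof. by move=> t0; apply/prodf_neq0 => j _; apply: expfz_neq0. Qed.

Lemma characterD (J : finType) (t : {ffun J -> C}) v v' :
  torus t -> character t (v + v') = character t v * character t v'.
Proof.
move=> t0; rewrite /character -big_split; apply: eq_bigr => j _.
by rewrite ffunE expfzDr.
Qed.

Lemma character0 (J : finType) (t : {ffun J -> C}) : character t 0 = 1.
Proof. by rewrite /character big1 // => j _; rewrite ffunE. Qed.

Lemma characterN (J : finType) (t : {ffun J -> C}) v :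
  character t (- v) = (character t v)^-1.
Proof.
rewrite /character -prodfV; apply: eq_bigr => j _.
by rewrite ffunE -invr_expz.
Qed.

Lemma characterB (J : finType) (t : {ffun J -> C}) v v' :
  torus t -> character t (v - v') = character t v / character t v'.
Proof. by move=> t0; rewrite characterD // characterN. Qed.

Lemma character_sum (J I : finType) (t : {ffun J -> C}) (v : I -> {ffun J -> int}) :
  torus t -> character t (\sum_i v i) = \prod_i character t (v i).
Proof.
move=> t0; elim/big_rec2: _ => [|i a b _ <-]; first exact: character0.
by rewrite characterD.
Qed.

Lemma characterMz (J : finType) (t : {ffun J -> C}) v (n : int) :
  character t (v *~ n) = character t v ^ n.
Proof.
rewrite /character; elim/big_rec2: _ => [|j a b _ ->]; first by rewrite exp1rz.
by rewrite expfzMl ffunMzE exprz_exp mulrzz.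
Qed.

Lemma character_mul (J : finType) (s t : {ffun J -> C}) v :
  character [ffun j => s j * t j] v = character s v * character t v.
Proof.
rewrite /character -big_split; apply: eq_bigr => j _.
by rewrite ffunE expfzMl.
Qed.

Definition monomial_map (E J : finType) (w : E -> {ffun J -> int})
    (s : {ffun J -> C}) : {ffun E -> C} := [ffun a => character s (w a)].

Definition peval (E : finType) (p : {mpoly C[#|E|]}) (y : E -> C) : C :=
  p.@[fun k => y (enum_val k)].

(* Two points of the torus are joined by a rational curve in the torus, namely
   a line with finitely many points removed. *)
Lemma torus_prime (E J : finType) (w : E -> {ffun J -> int}) (y : {ffun E -> C})
    (p q : {mpoly C[#|E|]}) (f := fun s => [ffun a => monomial_map w s a * y a]) :
  (forall s, torus s -> peval p (f s) * peval q (f s) = 0) ->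
  (forall s, torus s -> peval p (f s) = 0) \/
  (forall s, torus s -> peval q (f s) = 0).
Proof.
move=> pq0; apply: contrapT => /not_orP[/existsNP[s0 /not_implyP[s0T ps0]]].
move=> /existsNP[s1 /not_implyP[s1T qs1]].
pose l j : {poly C} := (s1 j - s0 j)%:P * 'X + (s0 j)%:P.
pose L := \prod_j l j.
pose sg z : {ffun J -> C} := [ffun j => (l j).[z]].
have sg0 : sg 0 = s0 by apply/ffunP=> j; rewrite !ffunE !hornerE.
have sg1 : sg 1 = s1 by apply/ffunP=> j; rewrite !ffunE !hornerE subrK.
have LE z : L.[z] = \prod_j sg z j.
  by rewrite horner_prod; apply: eq_bigr => j _; rewrite ffunE.
have LT z : L.[z] != 0 -> torus (sg z).
  by rewrite LE => /prodf_neq0 + j; exact.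
have lsg j : localized L (fun z => sg z j).
  by exists (l j), 0 => z _; rewrite ffunE mul1r.
have lsgV j : localized L (fun z => (sg z j)^-1).
  exists (\prod_(i | i != j) l i), 1%N => z Lz.
  rewrite expr1 horner_prod LE [in RHS](bigD1 j) //= mulrAC divff ?mul1r; last exact: LT.
  by apply: eq_bigr => i _; rewrite ffunE.
have lmon a : localized L (fun z => f (sg z) a).
  have : localized L (fun z => (\prod_j sg z j ^ w a j) * y a).
    apply: localizedM; last exact: localized_cst.
    apply: localized_prod => j; case: (w a j) => n; first exact: localizedX.
    have [P [M PE]] := localizedX n.+1 (lsgV j).
    by exists P, M => z Lz; rewrite PE // NegzE exprVn.
  case=> P [M PE]; exists P, M => z Lz; rewrite PE //; congr (_ * _).
  by rewrite /f ffunE [monomial_map _ _ _]ffunE.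
have [P [M PE]] := localized_meval p (fun k => lmon (enum_val k)).
have [Q [N QE]] := localized_meval q (fun k => lmon (enum_val k)).
have Lneq0 s z : torus s -> sg z = s -> L.[z] != 0.
  by move=> sT sgz; rewrite LE sgz; apply/prodf_neq0.
(* [P] and [Q] represent [p] and [q] along the line from [s0] (at 0) to [s1] (at 1), up to powers of
   [L]; the factor [L] covers the removed points. A vanishing [P] would contradict [ps0], a
   vanishing [Q] would contradict [qs1]. *)
have: P * Q * L = 0.
  apply: poly_vanishing => z; rewrite !hornerM.
  have [->|Lz] := eqVneq L.[z] 0; first by rewrite mulr0.
  have pq0z := pq0 (sg z) (LT _ Lz).
  by rewrite PE // QE // mulrACA [_.@[_] * _]pq0z mulr0 mul0r.
apply/eqP; rewrite !mulf_eq0 !negb_or -!andbA; apply/and3P; split.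
- apply: contra_not_neq ps0 => P0; apply/eqP.
  have := PE _ (Lneq0 _ _ s0T sg0); rewrite P0 horner0 sg0 => /esym/eqP.
  by rewrite mulf_eq0 expf_eq0 (negPf (Lneq0 _ _ s0T sg0)) andbF.
- apply: contra_not_neq qs1 => Q0; apply/eqP.
  have := QE _ (Lneq0 _ _ s1T sg1); rewrite Q0 horner0 sg1 => /esym/eqP.
  by rewrite mulf_eq0 expf_eq0 (negPf (Lneq0 _ _ s1T sg1)) andbF.
- by apply: contraNneq (Lneq0 _ _ s0T sg0) => ->; rewrite horner0.
Qed.

End Torus.

(** * Transcendence bound for chains of irreducible sets *)

Section UpperBound.
Variables (R : realType) (E : finType).
Local Notation C := R[i].
Implicit Types (p q : {mpoly C[#|E|]}) (W : set {ffun E -> C}).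

Lemma pevalM p q (y : E -> C) : peval (p * q) y = peval p y * peval q y.
Proof. exact: mevalM. Qed.

Lemma pevalXn p n (y : E -> C) : peval (p ^+ n) y = peval p y ^+ n.
Proof. exact: rmorphXn. Qed.

Lemma peval_sum (I : finType) (c : I -> C) (q : I -> {mpoly C[#|E|]}) (y : E -> C) :
  peval (\sum_i c i *: q i) y = \sum_i c i * peval (q i) y.
Proof. by rewrite /peval raddf_sum; apply: eq_bigr => i _ /=; rewrite mevalZ. Qed.

Definition vanishes_on W p := forall y, W y -> peval p y = 0.

(** For nonempty [W] this says that its vanishing ideal is prime, that is, that its Zariski closure
    is irreducible. It is phrased without closures because the sets in the chains below need not be
    closed in affine space. *)
Definition prime_set W := forall p q, vanishes_on W (p * q) ->
  vanishes_on W p \/ vanishes_on W q.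

Lemma prime_setX W p n y : prime_set W -> W y ->
  vanishes_on W (p ^+ n) -> vanishes_on W p.
Proof.
move=> Wp Wy; elim: n => [/(_ y Wy)|n IHn].
  by rewrite expr0 /peval meval1 => /eqP; rewrite oner_eq0.
by rewrite exprS => /Wp[|/IHn].
Qed.

Section PowerProducts.
Variables (P : nat -> {mpoly C[#|E|]}) (r : nat).

Fixpoint exponents (N : nat) : finType :=
  if N is N'.+1 then (exponents N' * 'I_r.+1)%type else unit.

Fixpoint power_product N : exponents N -> {mpoly C[#|E|]} :=
  if N is N'.+1 then fun k => power_product k.1 * P N' ^+ k.2 else fun=> 1.

Lemma card_exponents N : #|exponents N| = (r.+1 ^ N)%N.
Proof.
by elim: N => [|N IHN]; rewrite ?card_unit // card_prod IHN card_ord expnSr.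
Qed.

Lemma msize_power_product N (k : exponents N) :
  ((msize (power_product k)).-1 <= r * \sum_(i < N) (msize (P i)).-1)%N.
Proof.
have degM p q : ((msize (p * q)).-1 <= (msize p).-1 + (msize q).-1)%N.
  have [->|p0] := eqVneq p 0; first by rewrite mul0r msize0.
  have [->|q0] := eqVneq q 0; first by rewrite mulr0 msize0.
  rewrite msizeM //; move: p0 q0; rewrite -!msize_poly_eq0.
  by case: (msize p) => // m _; rewrite addSn /=; case: (msize q) => // n; rewrite addnS.
elim: N k => [k|N IHN [k j]] /=; first by rewrite msize1.
rewrite big_ord_recr mulnDr; apply: leq_trans (degM _ _) (leq_add (IHN k) _).
have degX n : ((msize (P N ^+ n)).-1 <= n * (msize (P N)).-1)%N.
  elim: n => [|n IHn]; first by rewrite expr0 msize1.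
  by rewrite exprS mulSn; apply: leq_trans (degM _ _) _; rewrite leq_add2l.
by apply: leq_trans (degX _) _; rewrite leq_mul2r -ltnS ltn_ord orbT.
Qed.

(* In a linear relation on [W N] one cancels the lowest power of [P N.-1], by
   primality, and restricts to [W N.-1], where [P N.-1] vanishes. *)
Lemma power_products_free (W : nat -> set {ffun E -> C}) N :
  (exists y, W 0 y) ->
  (forall i, (i <= N)%N -> prime_set (W i)) ->
  (forall i y, (i < N)%N -> W i y -> W i.+1 y) ->
  (forall i, (i < N)%N -> vanishes_on (W i) (P i)) ->
  (forall i, (i < N)%N -> ~ vanishes_on (W i.+1) (P i)) ->
  forall c : exponents N -> C,
    (forall y, W N y -> \sum_k c k * peval (power_product k) y = 0) ->
    forall k, c k = 0.
Proof.
move=> [y0 W0y0]; elim: N => [|N IHN] Wprime WS Pvan Pnvan c c0.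
  move=> k; have := c0 y0 W0y0.
  rewrite (bigD1 k) //= big1 => [|k']; last by case: k k' => [] [] /eqP.
  by rewrite addr0 /peval meval1 mulr1.
have WN y : W N y -> W N.+1 y by apply: WS.
have {}IHN := IHN (fun i le => Wprime i (leqW le)) (fun i y lt => WS i y (leqW lt))
  (fun i lt => Pvan i (leqW lt)) (fun i lt => Pnvan i (leqW lt)).
have yN1 : W N.+1 y0.
  have: forall i, (i <= N.+1)%N -> W i y0.
    by elim=> // i IHi lti; apply: WS => //; apply: IHi; apply: ltnW.
  exact.
suff: forall j : nat, forall k (jr : (j < r.+1)%N), c (k, Ordinal jr) = 0.
  by move=> cj [k [j jr]]; apply: cj.
move=> j; elim/ltn_ind: j => j IHj k jr.
(* The relation with [P N ^+ j] divided out. Terms below [j], already known to vanish, are replaced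
   by 0, since truncated subtraction would give them exponent 0. *)
pose Q := \sum_(k : exponents N.+1) (if (k.2 < j)%N then 0 else c k)
            *: (power_product k.1 * P N ^+ (k.2 - j)).
have: vanishes_on (W N.+1) (P N ^+ j * Q).
  move=> y Wy; rewrite pevalM peval_sum mulr_sumr -[RHS](c0 y Wy).
  apply: eq_bigr => -[k' j'] _ /=; case: ltnP => jj'.
    by case: j' jj' => j' ? ?; rewrite IHj // !mul0r mulr0.
  rewrite mulrCA -pevalM mulrCA -exprD subnKC //.
case/(Wprime N.+1 (leqnn _)) => [|Q0].
  by move/(prime_setX (Wprime _ (leqnn _)) yN1)/(Pnvan N (leqnn _)).
apply: (IHN (fun k => c (k, Ordinal jr))) => y Wy.
rewrite -[RHS](Q0 y (WN _ Wy)) peval_sum.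
transitivity (\sum_(k' : exponents N) \sum_(j' < r.+1)
    (if (j' < j)%N then 0 else c (k', j')) *
    peval (power_product k' * P N ^+ (j' - j)) y); last first.
  by rewrite pair_bigA; apply: eq_bigr => -[].
apply: eq_bigr => k' _; rewrite (bigD1 (Ordinal jr)) //= ltnn subnn expr0 mulr1.
rewrite big1 ?addr0 // => j' jj'; case: ltnP => [|lejj']; first by rewrite mul0r.
rewrite pevalM pevalXn (Pvan N (leqnn _) y Wy) expr0n subn_eq0 leqNgt.
by rewrite ltn_neqAle lejj' eq_sym -[X in ~~ (~~ X && _)](inj_eq val_inj j' (Ordinal jr)) jj' !mulr0.
Qed.

End PowerProducts.

Lemma linear_dependence (F : fieldType) (K J : finType) (A : K -> J -> F) :
  (#|J| < #|K|)%N ->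
  exists2 c : K -> F, exists k, c k != 0 & forall j, \sum_k c k * A k j = 0.
Proof.
move=> ltJK; pose M := \matrix_(k < #|K|, j < #|J|) A (enum_val k) (enum_val j).
have /rowV0Pn[v /sub_kermxP vM v0] : kermx M != 0.
  rewrite -mxrank_eq0 mxrank_ker -lt0n subn_gt0.
  exact: leq_ltn_trans (rank_leq_col _) ltJK.
have [k vk] : exists k, v 0 k != 0.
  apply/existsP; rewrite -negb_forall; apply: contra v0 => /forallP v0.
  by apply/eqP/rowP=> k; rewrite mxE; apply/eqP.
exists (fun k => v 0 (enum_rank k)) => [|j].
  by exists (enum_val k); rewrite enum_valK.
have /rowP/(_ (enum_rank j)) := vM; rewrite !mxE => vMj.
rewrite -[RHS]vMj [LHS](reindex _ (onW_bij _ (@enum_val_bij K))).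
by apply: eq_bigr => i _; rewrite enum_valK mxE enum_rankK.
Qed.

(** * Polynomial functions on torus translates *)

Section Torsors.
Variables (T : set {ffun E -> C}) (x : {ffun E -> C}).
Variables (N0 rho : nat) (m : 'I_rho -> {ffun E -> int}) (cc : E -> 'I_rho -> int).
Hypotheses (N0gt0 : (0 < N0)%N) (T_torus : forall t, T t -> torus t).
Hypothesis T_gen : forall t a, T t -> x a != 0 ->
  t a ^+ N0 = \prod_i character t (m i) ^ cc a i.

Let B := (\sum_a \sum_i `|cc a i|)%N.

Local Notation codes d :=
  ({ffun E -> 'I_N0} * {ffun 'I_rho -> 'I_(2 * B * d).+1})%type.

Let code_value d (k : codes d) (t : {ffun E -> C}) : C :=
  (\prod_(a | x a != 0) t a ^+ k.1 a) *
  \prod_i character t (m i) ^ ((k.2 i)%:Z - (B * d)%:Z).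

(** Each exponent is divided by [N0]: the remainders stay powers of coordinates, and the [N0]-th
    powers turn into the characters [m i]. The exponents of the latter lie between [- B * d] and
    [B * d], whence the shift by [B * d] and the range of the second component. *)
Let code d (u : E -> nat) : codes d :=
  ([ffun a => Ordinal (ltn_pmod (u a) N0gt0)],
   [ffun i => inord `|((B * d)%:Z + \sum_(a | x a != 0) cc a i * (u a %/ N0)%:Z)%R|]).

Lemma code_valueE d u t : T t -> (forall a, (u a <= d)%N) ->
  \prod_a (t a * x a) ^+ u a = (\prod_a x a ^+ u a) * code_value (code d u) t.
Proof.
(* If a variable that is zero at [x] occurs in the monomial, both sides vanish. Otherwise all
   variables that occur lie in the support of [x], where [T_gen] applies. *)
move=> Tt ud; have [/existsP[a /andP[xa ua]]|] := boolP [exists a, (x a == 0) && (0 < u a)%N].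
  rewrite (bigD1 a) //= [in RHS](bigD1 a) //= (eqP xa) mulr0 expr0n.
  by rewrite eqn0Ngt ua /= !mul0r.
rewrite negb_exists => /forallP u0.
rewrite (eq_bigr _ (fun a _ => exprMn _ _ _)) big_split mulrC; congr (_ * _).
rewrite (bigID (fun a => x a != 0)) /= [X in _ * X]big1 ?mulr1; last first.
  move=> a; rewrite negbK => xa; move: (u0 a); rewrite xa /= -eqn0Ngt => /eqP ->.
  by rewrite expr0.
rewrite /code_value /=.
have -> : \prod_i character t (m i) ^ (([ffun i => inord `|((B * d)%:Z +
    \sum_(a | x a != 0) cc a i * (u a %/ N0)%:Z)%R|] i : 'I_(2 * B * d).+1)%:Z
    - (B * d)%:Z) = \prod_(a | x a != 0) t a ^+ (N0 * (u a %/ N0)).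
  under [RHS]eq_bigr => a xa do rewrite exprM T_gen // -prodrXl.
  rewrite [RHS]exchange_big /=; apply: eq_bigr => i _.
  rewrite ffunE; set S := \sum_(a | _) _.
  have leS : (`|S| <= B * d)%N.
    have leS : (`|S| <= \sum_(a | x a != 0%R) `|cc a i| * d)%N.
      rewrite /S; elim/big_rec2: _ => // a b c _ lebc.
      have : (`|(cc a i * (u a %/ N0)%:Z)%R| <= `|cc a i| * d)%N.
        by rewrite abszM leq_mul2l absz_nat (leq_trans (leq_div _ _)) ?orbT.
      by lia.
    apply: leq_trans leS _; rewrite -big_distrl leq_mul2r; apply/orP; right.
    rewrite big_mkcond leq_sum // => a _; case: ifP => // _.
    by rewrite (bigD1 i) //= leq_addr.
  rewrite inordK; last by lia.
  have -> : (`|((B * d)%:Z + S)%R|%N)%:Z - (B * d)%:Z = S by lia.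
  rewrite /S (big_morph _ (fun _ _ => expfzDr _ _ (character_neq0 _ (T_torus Tt))) (expr0z _)).
  by apply: eq_bigr => a _; rewrite -exprz_exp.
rewrite -big_split; apply: eq_bigr => a _ /=.
by rewrite ffunE /= -exprD addnC mulnC -divn_eq.
Qed.

(** On the translate every monomial of degree at most [d] is a constant multiple of a code value, so
    it suffices to find a relation between coefficient vectors indexed by codes. *)
Lemma polynomials_dependent (K : finType) (q : K -> {mpoly C[#|E|]}) d :
  (forall k, ((msize (q k)).-1 <= d)%N) ->
  (N0 ^ #|E| * (2 * B * d).+1 ^ rho < #|K|)%N ->
  exists2 c : K -> C, exists k, c k != 0 &
    forall t, T t -> \sum_k c k * peval (q k) [ffun a => t a * x a] = 0.
Proof.
move=> qd ltK.
pose ex (u : 'X_{1..#|E|}) a := u (enum_rank a).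
pose A k (j : codes d) := \sum_(u <- msupp (q k) | code d (ex u) == j)
  (q k)@_u * \prod_a x a ^+ ex u a.
have [|c cN0 cA] := linear_dependence A.
  by rewrite card_prod !card_ffun !card_ord.
exists c => // t Tt; transitivity (\sum_k \sum_j c k * A k j * code_value j t).
  apply: eq_bigr => k _; under [RHS]eq_bigr do rewrite -mulrA.
  rewrite -mulr_sumr; congr (_ * _); rewrite /peval mevalE.
  transitivity (\sum_(u <- msupp (q k)) (q k)@_u *
    ((\prod_a x a ^+ ex u a) * code_value (code d (ex u)) t)).
    apply: eq_big_seq => u uq; rewrite -code_valueE // => [|a].
      congr (_ * _); rewrite [RHS](reindex _ (onW_bij _ (@enum_val_bij E))).
      by apply: eq_bigr => i _; rewrite ffunE /ex enum_valK.
    apply: leq_trans (qd k); rewrite -ltnS.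
    have := msize_mdeg_lt uq; case: (msize _) => // n; apply: leq_trans.
    by rewrite ltnS mdegE (bigD1 (enum_rank a)) //= leq_addr.
  rewrite (partition_big (fun u => code d (ex u)) xpredT) //=.
  apply: eq_bigr => j _; rewrite mulr_suml; apply: eq_bigr => u /eqP <-.
  by rewrite mulrA.
rewrite exchange_big big1 // => j _.
by rewrite -mulr_suml cA mul0r.
Qed.

(* There are (r + 1)^N power products with exponents at most r, all of them in a
   space of dimension O(r^rho). *)
Lemma chain_bound (W : nat -> set {ffun E -> C}) (P : nat -> {mpoly C[#|E|]}) N :
  (exists y, W 0 y) ->
  (forall y, W N y -> exists2 t, T t & y = [ffun a => t a * x a]) ->
  (forall i, (i <= N)%N -> prime_set (W i)) ->
  (forall i y, (i < N)%N -> W i y -> W i.+1 y) ->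
  (forall i, (i < N)%N -> vanishes_on (W i) (P i)) ->
  (forall i, (i < N)%N -> ~ vanishes_on (W i.+1) (P i)) ->
  (N <= rho)%N.
Proof.
move=> W0 WT Wprime WS Pvan Pnvan; rewrite leqNgt; apply/negP => ltN.
pose D := (\sum_(i < N) (msize (P i)).-1)%N.
(* Since [2 * B * (r * D) + 1] is at most [(2 * B * D + 1) * (r + 1)], this choice bounds the number
   of codes by [r * (r + 1) ^ rho], which is less than [(r + 1) ^ (rho + 1)]. *)
pose r := (N0 ^ #|E| * (2 * B * D).+1 ^ rho)%N.
have [|c [k ck] c0] := @polynomials_dependent (exponents r N)
  (@power_product P r N) _ (@msize_power_product P r N).
  rewrite card_exponents; apply: (@leq_trans (r.+1 ^ rho.+1)); last by rewrite leq_pexp2l.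
  rewrite -/D expnS; apply: (@leq_ltn_trans (r * r.+1 ^ rho)).
    have rE : r = (N0 ^ #|E| * (2 * B * D).+1 ^ rho)%N by [].
    rewrite [X in (_ <= X * _)%N]rE -[X in (_ <= X)%N]mulnA -expnMn leq_mul2l; apply/orP; right.
    have [->|rho0] := posnP rho; first by rewrite !expn0.
    by rewrite leq_exp2r //; nia.
  by rewrite ltn_pmul2r ?expn_gt0.
move/eqP: ck; apply; apply: (power_products_free W0 Wprime WS Pvan Pnvan) => y /WT[t Tt ->].
exact: c0.
Qed.

End Torsors.

End UpperBound.

(** * Krull dimension of torus orbits *)

Section OrbitDimension.
Variables (R : realType) (G : brane_tiling).
Local Notation C := R[i].
Local Notation point := {ffun edge G -> C}.
Local Notation weight := {ffun edge G -> int}.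
Implicit Types (y t : point) (m : weight).

Lemma character_monomial_map (E J : finType) (w : E -> {ffun J -> int})
    (s : {ffun J -> C}) (v : {ffun E -> int}) : torus s ->
  character (monomial_map w s) v = character s [ffun j => \sum_a v a * w a j].
Proof.
move=> sT; rewrite {1}/character (eq_bigr (fun a => character s (w a *~ v a))).
  rewrite -character_sum //; congr character; apply/ffunP=> j.
  rewrite sum_ffunE ffunE; apply: eq_bigr => a _.
  by rewrite ffunMzE mulrzz mulrC.
by move=> a _; rewrite ffunE characterMz.
Qed.

Lemma torus_monomial_map (E J : finType) (w : E -> {ffun J -> int}) s :
  torus s -> torus (monomial_map w s : {ffun E -> C}).
Proof. by move=> sT a; rewrite ffunE character_neq0. Qed.

Lemma torus1 (J : finType) : torus ([ffun=> 1] : {ffun J -> C}).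
Proof. by move=> j; rewrite ffunE oner_eq0. Qed.

Lemma character1 (J : finType) (v : {ffun J -> int}) :
  character ([ffun=> 1] : {ffun J -> C}) v = 1.
Proof. by rewrite /character big1 // => j _; rewrite ffunE exp1rz. Qed.

Lemma act_act t t' y : act t (act t' y) = act [ffun a => t a * t' a] y.
Proof. by apply/ffunP=> a; rewrite !ffunE mulrA. Qed.

Local Notation gauge g := (monomial_map (@d1 G) g : point).

Lemma iso_class_refl y : iso_class y y.
Proof.
exists [ffun=> 1]; first exact: torus1.
by apply/ffunP=> a; rewrite !ffunE character1 mul1r.
Qed.

Lemma iso_classP y y' : iso_class y = iso_class y' <->
  exists2 g, torus g & y = act (gauge g) y'.
Proof.
split=> [yy'|[g gT ->]].
  by have := iso_class_refl y; rewrite yy' => -[g gT <-]; exists g.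
apply/seteqP; split=> _ [g' g'T <-].
  exists [ffun i => g' i * g i] => [i|].
    by rewrite ffunE mulf_neq0 ?g'T ?gT.
  by apply/ffunP=> a; rewrite !ffunE character_mul mulrA.
exists [ffun i => g' i / g i] => [i|].
  by rewrite ffunE mulf_neq0 ?invr_neq0 ?g'T ?gT.
apply/ffunP=> a; rewrite !ffunE mulrA -character_mul; congr (character _ _ * _).
by apply/ffunP=> i; rewrite !ffunE divfK ?gT.
Qed.

Section PositivePart.

(** The positive part of a Laurent monomial, which makes sense also at points with zero coordinates.
    On the torus the character [m] is the quotient of the positive parts of [m] and [- m]. *)
Definition pos_power m y := \prod_a y a ^+ `|Num.max (m a) 0|%N.

Lemma pos_powerM m t y : pos_power m (act t y) = pos_power m t * pos_power m y.
Proof.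
rewrite /pos_power -big_split; apply: eq_bigr => a _.
by rewrite ffunE exprMn.
Qed.

Lemma pos_power_character m t : torus t ->
  pos_power m t = character t m * pos_power (- m) t.
Proof.
move=> tT; rewrite /pos_power -big_split; apply: eq_bigr => a _ /=.
rewrite ffunE; case: (m a) => n.
  by rewrite max_l // max_r ?oppr_le0 // mulr1.
rewrite NegzE opprK max_r ?oppr_le0 // max_l // expr0.
by rewrite mulVf // expf_eq0 negb_and tT orbT.
Qed.

Lemma pos_power_neq0 m y : (forall a, y a = 0 -> m a = 0) -> pos_power m y != 0.
Proof.
move=> my; apply/prodf_neq0=> a _; rewrite expf_eq0 negb_and -leqNgt.
by have [/my ->|] := eqVneq (y a) 0; rewrite ?maxxx ?orbT.
Qed.

(* The equation [(y / y0)^m = 1], with denominators cleared. *)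
Definition binomial m y0 : {mpoly C[#|edge G|]} :=
  let mono m := 'X_[ [multinom `|Num.max (m (enum_val k)) 0|%N | k < #|edge G|] ]
  in pos_power (- m) y0 *: mono m - pos_power m y0 *: mono (- m).

Lemma peval_binomial m y0 y : peval (binomial m y0) y =
  pos_power (- m) y0 * pos_power m y - pos_power m y0 * pos_power (- m) y.
Proof.
rewrite /peval mevalB !mevalZ !mevalX /pos_power.
congr (_ * _ - _ * _); rewrite [RHS](reindex _ (onW_bij _ (@enum_val_bij _)));
  by apply: eq_bigr => k _; rewrite mnmE.
Qed.

Lemma binomial_root m y0 t : torus t -> (forall a, y0 a = 0 -> m a = 0) ->
  peval (binomial m y0) (act t y0) = 0 <-> character t m = 1.
Proof.
move=> tT my; have mNy a : y0 a = 0 -> (- m) a = 0 by move=> ?; rewrite ffunE my ?oppr0.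
rewrite peval_binomial !pos_powerM (pos_power_character _ tT).
have -> : pos_power (- m) y0 * (character t m * pos_power (- m) t * pos_power m y0)
  - pos_power m y0 * (pos_power (- m) t * pos_power (- m) y0) =
  (character t m - 1) * (pos_power (- m) t * pos_power m y0 * pos_power (- m) y0).
  by ring.
split=> [/eqP|->]; last by rewrite subrr mul0r.
rewrite !mulf_eq0 !(negPf (pos_power_neq0 _)) ?orbF //.
  by rewrite subr_eq0 => /eqP.
by move=> a /eqP ta; have := tT a; rewrite ta.
Qed.

End PositivePart.

Lemma zariski_closed_vanishing (S : set {mpoly C[#|edge G|]}) :
  zariski_closed [set y : point | forall p, S p -> peval p y = 0]%classic.
Proof. by exists S. Qed.

Lemma peval_scaled (p : {mpoly C[#|edge G|]}) t :
  exists q : {mpoly C[#|edge G|]}, forall y, peval q y = peval p (act t y).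
Proof.
exists (p \mPo [tuple t (enum_val k) *: 'X_k | k < #|edge G|]) => y.
rewrite /peval comp_mpoly_meval; apply: meval_eq => k.
by rewrite tnth_mktuple mevalZ mevalXU ffunE.
Qed.

(** * Chains of irreducible closed sets in an orbit *)

Section KrullDimension.
Variables (theta : {ffun Q0 G -> int}) (x : point).
Hypothesis x_ss : semistable theta x.
Hypothesis T_ss : forall t y, T_Lambda t -> semistable theta y ->
  semistable theta (act t y).
Hypothesis T_gauge : forall g, torus g -> T_Lambda (gauge g).

(** The [nu i] are cocharacters of [T_Lambda], the [m i] characters supported off the cosupport and
    dual to them up to the factors [D i]. The first [h] cocharacters act on [x] by changes of basis;
    the last [e] characters are trivial on changes of basis and hence descend to the quotient. *)
Variables (h e : nat) (m nu : nat -> weight) (D : nat -> int).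
Hypothesis nu_T : forall i F F', (i < h + e)%N ->
  \sum_a (d2 F - d2 F') a * nu i a = 0.
Hypothesis m_nu : forall i j, (i < h + e)%N -> (j < h + e)%N ->
  \sum_a m i a * nu j a = D i *+ (i == j).
Hypothesis D_neq0 : forall i, (i < h + e)%N -> D i != 0.
Hypothesis m_supp : forall i a, x a = 0 -> m i a = 0.
Hypothesis nu_gauge : forall i, (i < h)%N ->
  exists c : {ffun Q0 G -> int}, forall a, x a != 0 -> nu i a = \sum_q c q * d1 a q.
Hypothesis m_gauge : forall i q, (h <= i < h + e)%N -> \sum_a m i a * d1 a q = 0.

Let orbit_pt y := exists2 t, T_Lambda t & y = act t x.

Let wt k (a : edge G) : {ffun 'I_k -> int} := [ffun j : 'I_k => nu j a].

Let wtE k a (j : 'I_k) : wt k a j = nu j a.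
Proof. by rewrite ffunE. Qed.

Let subtorus k y : set point :=
  [set act (monomial_map (wt k) s) y | s in torus (J := 'I_k)]%classic.

Lemma T_Lambda_mul t t' : T_Lambda t -> T_Lambda t' ->
  T_Lambda ([ffun a => t a * t' a] : point).
Proof.
move=> [tT t1] [t'T t'1]; split=> [a|F F'].
  by rewrite ffunE mulf_neq0 ?tT ?t'T.
by rewrite character_mul t1 t'1 mulr1.
Qed.

Lemma orbit_pt_ss y : orbit_pt y -> semistable theta y.
Proof. by case=> t Tt ->; apply: T_ss. Qed.

Lemma orbit_pt_act t y : T_Lambda t -> orbit_pt y -> orbit_pt (act t y).
Proof.
move=> Tt [t' Tt' ->]; exists [ffun a => t a * t' a]; first exact: T_Lambda_mul.
by rewrite act_act.
Qed.

Lemma orbit_pt_x : orbit_pt x.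
Proof.
exists (gauge [ffun=> 1]); first exact/T_gauge/torus1.
by apply/ffunP=> a; rewrite !ffunE character1 mul1r.
Qed.

Lemma orbit_pt_eq0 y a : orbit_pt y -> (y a == 0) = (x a == 0).
Proof. by case=> t [tT _] ->; rewrite ffunE mulf_eq0 (negPf (tT a)). Qed.

Lemma orbit_pt_iso_class y : orbit_pt y -> T_M_orbit x (iso_class y).
Proof. by case=> t Tt ->; exists t. Qed.

Lemma subtorus_T k (s : {ffun 'I_k -> C}) : (k <= h + e)%N -> torus s ->
  T_Lambda (monomial_map (wt k) s).
Proof.
move=> kle sT; split=> [|F F']; first exact: torus_monomial_map.
rewrite character_monomial_map // /character big1 // => j _; rewrite ffunE.
under eq_bigr do rewrite wtE.
by rewrite nu_T ?expr0z // (leq_trans _ kle).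
Qed.

Lemma subtorus_orbit_pt k y y' : (k <= h + e)%N -> orbit_pt y ->
  subtorus k y y' -> orbit_pt y'.
Proof. by move=> kle yO [s sT <-]; apply: orbit_pt_act => //; apply: subtorus_T. Qed.

Lemma subtorus_character k (s : {ffun 'I_k -> C}) i : (k <= h + e)%N ->
  (i < h + e)%N -> torus s ->
  character (monomial_map (wt k) s) (m i) =
    if insub i is Some j then s j ^ D i else 1.
Proof.
move=> kle ilt sT; rewrite character_monomial_map // /character.
have sE (j : 'I_k) : s j ^ [ffun j => \sum_a m i a * wt k a j] j
    = s j ^ (D i *+ (i == j)).
  rewrite ffunE -m_nu // ?(leq_trans _ kle) //; congr (_ ^ _).
  by apply: eq_bigr => a _; rewrite wtE.
under eq_bigr do rewrite sE.
case: insubP => [j _ ji|ik].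
  rewrite (bigD1 j) //= big1 => [|j' /negPf jj']; first by rewrite ji eqxx mulr1.
  by rewrite -ji (inj_eq val_inj) eq_sym jj'.
rewrite big1 // => j _; case: eqP => // ij; move: ik.
by rewrite ij ltn_ord.
Qed.

Lemma subtorus_refl k y : subtorus k y y.
Proof.
exists [ffun=> 1]; first exact: torus1.
by apply/ffunP=> a; rewrite !ffunE character1 mul1r.
Qed.

Lemma subtorusS k y y' : (k < h + e)%N -> subtorus k y y' -> subtorus k.+1 y y'.
Proof.
move=> kle [s sT <-].
exists [ffun j => if unlift ord_max j is Some j' then s j' else 1] => [j|].
  by rewrite ffunE; case: unliftP => [j' _|_]; rewrite ?oner_eq0.
congr act; apply/ffunP=> a; rewrite !ffunE /character big_ord_recr /= !ffunE.
rewrite unlift_none exp1rz mulr1; apply: eq_bigr => j _.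
have -> : widen_ord (leqnSn k) j = lift ord_max j by apply: val_inj; rewrite /= /bump leqNgt ltn_ord.
by rewrite !ffunE liftK lift_max.
Qed.

Lemma subtorus_prime k y : prime_set (subtorus k y).
Proof.
move=> p q pq0; have [s sT|p0|q0] := @torus_prime R _ _ (wt k) y p q.
- by rewrite -pevalM; apply: pq0; exists s.
- by left=> _ [s sT <-]; apply: p0.
- by right=> _ [s sT <-]; apply: q0.
Qed.

(** The character [m k] pairs to 0 with the first [k] cocharacters and to [D k] with the next one,
    so its binomial separates consecutive orbits. *)
Lemma binomial_subtorus k y : (k < h + e)%N -> orbit_pt y ->
  vanishes_on (subtorus k y) (binomial (m k) y) /\
  exists2 y', subtorus k.+1 y y' & peval (binomial (m k) y) y' <> 0.
Proof.
move=> klt yO; have my a : y a = 0 -> m k a = 0.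
  by move/eqP; rewrite (orbit_pt_eq0 _ yO) => /eqP /m_supp.
split=> [_ [s sT <-]|].
  apply/(binomial_root (torus_monomial_map _ sT) my).
  by rewrite subtorus_character ?(ltnW klt) // insubF // ltnn.
(* The character takes the value [2 ^ D k] here; any number that is not a root of unity could
   replace 2. *)
pose s : {ffun 'I_k.+1 -> C} := [ffun=> 2].
have sT : torus s by move=> j; rewrite ffunE pnatr_eq0.
exists (act (monomial_map (wt k.+1) s) y); first by exists s.
move/(binomial_root (torus_monomial_map _ sT) my).
rewrite subtorus_character //; case: insubP => [j _ _|]; last by rewrite ltnSn.
rewrite ffunE => /eqP.
rewrite -[_ == _]/((2 : C) ^ D k == 1).
have := D_neq0 klt; case: (D k) => [[|n]|n] // _.
  by rewrite -exprnP pexpr_eq1 ?ler0n // (eqr_nat _ 2 1).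
by rewrite NegzE -exprnN invr_eq1 pexpr_eq1 ?ler0n // (eqr_nat _ 2 1).
Qed.

Section Closure.

Definition closure (Y : set (set point)) : set (set point) :=
  [set c | moduli theta c /\ forall Z, moduli_closed theta Z -> (Y `<=` Z -> Z c)]%classic.

(** An intersection of zero loci is the zero locus of all polynomials that vanish on one of them.
    The [good] loci are those that cut out closed sets containing [Y]. *)
Lemma closure_closed Y : moduli_closed theta (closure Y).
Proof.
split=> [c []//|].
pose good (V : set point) := zariski_closed V /\ exists2 Z : set (set point),
  (Z `<=` moduli theta /\ Y `<=` Z)%classic &
  forall y, semistable theta y -> (Z (iso_class y) <-> V y).
exists [set y | forall V, good V -> V y]%classic.
  exists [set p | exists2 V, good V & vanishes_on V p]%classic.
  apply/seteqP; split=> y /= yV p; first by case=> V /yV Vy; apply.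
  move=> [[S VE] Zgood]; rewrite VE => q Sq.
  apply: yV; exists p; first by split=> //; exists S.
  by rewrite VE => z; apply.
move=> y y_ss; split=> [[_ yZ] V [Vcl [Z [Zmod YZ] ZV]]|yV].
  by apply/ZV => //; apply: yZ => //; split=> //; exists V.
split=> [|Z [Zmod [V Vcl ZV]] YZ]; first by exists y.
by apply/ZV => //; apply: yV; split=> //; exists Z.
Qed.

Lemma closure_min Y Z : moduli_closed theta Z -> (Y `<=` Z -> closure Y `<=` Z)%classic.
Proof. by move=> Zcl YZ c [_]; apply. Qed.

Lemma sub_closure Y : (Y `<=` moduli theta -> Y `<=` closure Y)%classic.
Proof. by move=> Ymod c Yc; split=> [|Z _]; [apply: Ymod | apply]. Qed.

Lemma moduli_closed_zeros (S : set {mpoly C[#|edge G|]}) :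
  (forall g y, torus g -> (forall p, S p -> peval p y = 0) ->
     forall p, S p -> peval p (act (gauge g) y) = 0) ->
  moduli_closed theta [set c | exists2 y, semistable theta y /\ c = iso_class y &
    forall p, S p -> peval p y = 0]%classic.
Proof.
move=> Sg; split=> [c [y [y_ss ->] _]|]; first by exists y.
exists [set y : point | forall p, S p -> peval p y = 0]%classic.
  exact: zariski_closed_vanishing.
move=> y y_ss; split=> [[y' [_ /iso_classP[g gT ->]] Sy']|]; last by exists y.
exact: Sg.
Qed.

End Closure.

Local Notation orbit_cl := (induced (moduli_closed theta) (T_M_orbit x)).

Let stratum k : set (set point) := [set iso_class y | y in subtorus (h + k) x]%classic.

Let stratum_orbit k : (k <= e)%N -> (stratum k `<=` T_M_orbit x)%classic.
Proof.
move=> ke _ [y yS <-]; apply: orbit_pt_iso_class.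
by apply: subtorus_orbit_pt yS; [rewrite leq_add2l | exact: orbit_pt_x].
Qed.

Let stratum_closure k : (k <= e)%N -> (stratum k `<=` closure (stratum k))%classic.
Proof.
move=> ke; apply: sub_closure => _ [y yS <-]; exists y => //; apply: orbit_pt_ss.
by apply: subtorus_orbit_pt yS; [rewrite leq_add2l | exact: orbit_pt_x].
Qed.

(** A closed set that contains the stratum contains its closure, so irreducibility can be tested on
    the stratum itself, the image of a torus. *)
Lemma stratum_irreducible k : (k <= e)%N ->
  irreducible orbit_cl (T_M_orbit x `&` closure (stratum k))%classic.
Proof.
move=> ke; split.
  exists (iso_class x); split; first exact/orbit_pt_iso_class/orbit_pt_x.
  by apply: stratum_closure => //; exists x => //; apply: subtorus_refl.
move=> _ _ [A Acl <-] [B Bcl <-] ZAB.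
have stratumAB : (stratum k `<=` A `|` B)%classic.
  move=> c ck; have [|[_ ?]|[_ ?]] := ZAB c; [|by left|by right].
  by split; [exact: (stratum_orbit ke) | exact: stratum_closure].
suff [kA|kB] : (stratum k `<=` A \/ stratum k `<=` B)%classic.
- by left=> c [cO /(closure_min Acl kA)].
- by right=> c [cO /(closure_min Bcl kB)].
have [Amod [VA [SA VAE] AV]] := Acl; have [Bmod [VB [SB VBE] BV]] := Bcl.
have ss y : subtorus (h + k) x y -> semistable theta y.
  move=> yS; apply: orbit_pt_ss; apply: subtorus_orbit_pt yS; last exact: orbit_pt_x.
  by rewrite leq_add2l.
apply: contrapT => /not_orP[nA nB].
have [p Sp pN0] : exists2 p, SA p & ~ vanishes_on (subtorus (h + k) x) p.
  apply: contrapT => noP; apply: nA => _ [y yS <-]; apply/AV; first exact: ss.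
  by rewrite VAE => p Sp; apply: contrapT => py; apply: noP; exists p => // /(_ y yS).
have [q Sq qN0] : exists2 q, SB q & ~ vanishes_on (subtorus (h + k) x) q.
  apply: contrapT => noP; apply: nB => _ [y yS <-]; apply/BV; first exact: ss.
  by rewrite VBE => q Sq; apply: contrapT => qy; apply: noP; exists q => // /(_ y yS).
have [|//|//] := @subtorus_prime (h + k) x p q.
move=> y yS; rewrite pevalM; have [||] := stratumAB (iso_class y); first by exists y.
  by move/(AV _ (ss _ yS)); rewrite VAE => /(_ p Sp); rewrite /peval => ->; rewrite mul0r.
by move/(BV _ (ss _ yS)); rewrite VBE => /(_ q Sq); rewrite /peval => ->; rewrite mulr0.
Qed.

(** The strata start with [h] cocharacters, which do not leave the isomorphism class of [x]. From
    then on the binomial of [m (h + k)] is gauge invariant up to a common factor of its two terms,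
    so its zeros form a closed set of the moduli space, which contains [stratum k] but not
    [stratum k.+1]. *)
Lemma orbit_irred_chain : irred_chain orbit_cl e.
Proof.
exists (fun k => T_M_orbit x `&` closure (stratum k))%classic; split=> [k ke|k ke].
  split; last exact: stratum_irreducible.
  by exists (closure (stratum k)) => //; apply: closure_closed.
have klt : (h + k < h + e)%N by rewrite ltn_add2l.
have SS : (stratum k `<=` stratum k.+1)%classic.
  by move=> _ [y yS <-]; exists y => //; rewrite addnS; apply: subtorusS.
split=> [c [cO cZ]|].
  split=> //; apply: closure_min cZ; first exact: closure_closed.
  exact: classical_sets.subset_trans SS (stratum_closure ke).
have [van [y yS yN0]] := binomial_subtorus klt orbit_pt_x => sub.
have yO : orbit_pt y by apply: subtorus_orbit_pt yS; [|exact: orbit_pt_x].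
have Sy : stratum k.+1 (iso_class y) by exists y => //; rewrite addnS.
have [|_ /closure_min cl] := sub (iso_class y).
  by split; [exact: stratum_orbit Sy | exact: stratum_closure Sy].
pose S : set {mpoly C[#|edge G|]} := [set binomial (m (h + k)) x]%classic.
have gaugeS g y' : torus g -> (forall p, S p -> peval p y' = 0) ->
    forall p, S p -> peval p (act (gauge g) y') = 0.
  move=> gT Sy' _ ->; have := Sy' _ erefl.
  rewrite !peval_binomial !pos_powerM (pos_power_character _ (torus_monomial_map _ gT)).
  rewrite character_monomial_map // /character big1 ?mul1r => [y'0|q _].
    rewrite mulrCA [X in _ - X]mulrCA -mulrBr y'0 mulr0 //.
  by rewrite ffunE m_gauge ?expr0z // leq_addr.
have [|y' [_ /iso_classP[g gT yy']] Sy'] := cl _ (moduli_closed_zeros gaugeS).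
  move=> _ [z zS <-]; exists z; last by move=> _ ->; apply: van.
  split=> //; apply: orbit_pt_ss; apply: subtorus_orbit_pt zS; last exact: orbit_pt_x.
  exact: ltnW.
by apply: yN0; rewrite yy'; apply: (gaugeS g y' gT Sy').
Qed.

Section GaugeTranslates.
Variable p : {mpoly C[#|edge G|]}.

Let translates : set {mpoly C[#|edge G|]} :=
  [set q | exists2 g, torus g & forall y, peval q y = peval p (act (gauge g) y)]%classic.

Let translatesP y :
  (forall q, translates q -> peval q y = 0) <->
  forall g, torus g -> peval p (act (gauge g) y) = 0.
Proof.
split=> [qy g gT|py q [g gT ->]]; last exact: py.
have [q qE] := peval_scaled p (gauge g).
by rewrite -qE; apply: qy; exists g.
Qed.

(** Vanishing of [p] is no condition on isomorphism classes, but vanishing of all its gauge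
    translates is one, and each translate is again a polynomial. *)
Lemma moduli_closed_translates :
  moduli_closed theta [set c | exists2 y, semistable theta y /\ c = iso_class y &
    forall g, torus g -> peval p (act (gauge g) y) = 0]%classic.
Proof.
have -> : [set c | exists2 y, semistable theta y /\ c = iso_class y &
    forall g, torus g -> peval p (act (gauge g) y) = 0]%classic =
  [set c | exists2 y, semistable theta y /\ c = iso_class y &
    forall q, translates q -> peval q y = 0]%classic.
  by apply/seteqP; split=> c [y yc /translatesP py]; exists y.
apply: moduli_closed_zeros => g y gT /translatesP py; apply/translatesP => g' g'T.
have [g'' g''T ->] : exists2 g'', torus g'' &
    act (gauge g') (act (gauge g) y) = act (gauge g'') y; last exact: py.
  exists [ffun i => g' i * g i] => [i|]; first by rewrite ffunE mulf_neq0 ?g'T ?gT.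
  by apply/ffunP=> a; rewrite !ffunE character_mul mulrA.
Qed.

End GaugeTranslates.

Let lift_set (Z : set (set point)) : set point :=
  [set y | orbit_pt y /\ Z (iso_class y)]%classic.

Lemma lift_set_gauge Z g y : torus g -> lift_set Z y -> lift_set Z (act (gauge g) y).
Proof.
move=> gT [yO Zy]; split; first by apply: orbit_pt_act => //; apply: T_gauge.
suff -> : iso_class (act (gauge g) y) = iso_class y by [].
by apply/iso_classP; exists g.
Qed.

(* The lift is irreducible because the gauge group is: of two functions whose
   product vanishes, one vanishes on the whole gauge orbit of a given point. *)
Lemma lift_set_prime Z : (Z `<=` T_M_orbit x)%classic -> irreducible orbit_cl Z ->
  prime_set (lift_set Z).
Proof.
move=> ZO [_ Zirr] p q pq0.
pose A p' := [set c | exists2 y, semistable theta y /\ c = iso_class y &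
    forall g, torus g -> peval p' (act (gauge g) y) = 0]%classic.
have Acl p' : orbit_cl (T_M_orbit x `&` A p')%classic.
  by exists (A p') => //; apply: moduli_closed_translates.
have Avan p' : (Z `<=` T_M_orbit x `&` A p')%classic -> vanishes_on (lift_set Z) p'.
  move=> ZA y [yO /ZA[_ [y' [_ /iso_classP[g gT ->]] p'0]]]; exact: p'0.
have [|/Avan|/Avan] := Zirr _ _ (Acl p) (Acl q); [|by left|by right].
move=> c Zc; have [t Tt cE] := ZO c Zc.
have yO : orbit_pt (act t x) by exists t.
have yZ : lift_set Z (act t x) by split=> //; rewrite cE.
have [g gT|p0|q0] := @torus_prime R _ _ (@d1 G) (act t x) p q.
- by rewrite -pevalM; apply: pq0; apply: lift_set_gauge.
- by left; split; [exact: ZO|exists (act t x) => //; split=> //; exact: orbit_pt_ss].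
- by right; split; [exact: ZO|exists (act t x) => //; split=> //; exact: orbit_pt_ss].
Qed.

Lemma lift_set_separation Z Z' : orbit_cl Z -> (Z' `<=` T_M_orbit x)%classic ->
  (Z `<` Z')%classic ->
  exists2 p, vanishes_on (lift_set Z) p & ~ vanishes_on (lift_set Z') p.
Proof.
move=> [A [Amod [V [S VE] AV]] ZE] Z'O [_ Z'Z].
have [c [Z'c Zc]] : exists c, Z' c /\ ~ Z c.
  apply: contrapT => noc; apply: Z'Z => c Z'c; apply: contrapT => Zc.
  by apply: noc; exists c.
have [t Tt cE] := Z'O c Z'c; have yO : orbit_pt (act t x) by exists t.
have nV : ~ V (act t x).
  move=> /(AV _ (orbit_pt_ss yO)) Ay; apply: Zc; rewrite -ZE -cE.
  by split=> //; apply: orbit_pt_iso_class.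
have [p Sp py] : exists2 p, S p & peval p (act t x) <> 0.
  apply: contrapT => nop; apply: nV; rewrite VE => p Sp; apply: contrapT => py.
  by apply: nop; exists p.
exists p => [y [y_O Zy]|pvan]; last first.
  by apply: py; apply: pvan; split=> //; rewrite cE.
move: Zy; rewrite -ZE => -[_ /(AV _ (orbit_pt_ss y_O))]; rewrite VE; exact.
Qed.

Variables (N0 : nat) (cc : edge G -> 'I_(h + e) -> int).
Hypotheses (N0_gt0 : (0 < N0)%N) (T_gen : forall t a, T_Lambda t -> x a != 0 ->
  t a ^+ N0 = \prod_(i < h + e) character t (m i) ^ cc a i).

(** It is enough that [nu i] agrees with a coboundary on the support of [x], because the other
    coordinates vanish along the whole orbit. *)
Lemma subtorus_gauge y s : orbit_pt y -> torus s ->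
  exists2 g, torus g & act (monomial_map (wt h) s) y = act (gauge g) y.
Proof.
move=> yO sT; have [c cE] := boolp.choice (fun i : 'I_h => nu_gauge (ltn_ord i)).
exists (monomial_map (fun q => [ffun i => c i q]) s); first exact: torus_monomial_map.
apply/ffunP=> a; rewrite !ffunE.
have [/eqP xa|xa] := eqVneq (x a) 0.
  by move: xa; rewrite -(orbit_pt_eq0 a yO) => /eqP ->; rewrite !mulr0.
congr (_ * _); rewrite character_monomial_map //; congr character; apply/ffunP=> i.
rewrite !ffunE cE //; apply: eq_bigr => q _.
by rewrite ffunE mulrC.
Qed.

(* Lifting a chain from the orbit to [T_Lambda x] and inserting below it a chain
   of length [h] in a single gauge orbit reduces this to [chain_bound]. *)
Lemma orbit_chain_bound n : irred_chain orbit_cl n -> (n <= e)%N.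
Proof.
move=> [Z [Zcl ZS]].
have ZO i : (i <= n)%N -> (Z i `<=` T_M_orbit x)%classic.
  by move=> /Zcl[[A _ <-] _] c [].
have [c Zc] : exists c, Z 0 c by have [_ [[c ?] _]] := Zcl 0 (leq0n _); exists c.
have [t Tt cE] := ZO 0 (leq0n _) c Zc; pose y0 := act t x.
have y0O : orbit_pt y0 by exists t.
have Zy0 : lift_set (Z 0) y0 by split=> //; rewrite cE.
have /boolp.choice[p pE] : forall i, exists p, (i < n)%N ->
    vanishes_on (lift_set (Z i)) p /\ ~ vanishes_on (lift_set (Z i.+1)) p.
  move=> i; case: (ltnP i n) => [lt|_]; last by exists 0.
  have [p pv pnv] := lift_set_separation (proj1 (Zcl i (ltnW lt))) (ZO _ lt) (ZS i lt).
  by exists p.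
pose W k := if (k < h)%N then subtorus k y0 else lift_set (Z (k - h)%N).
pose P k := if (k < h)%N then binomial (m k) y0 else p (k - h)%N.
(* At [k.+1 = h] the inserted chain meets the lifted one: [subtorus h y0] lies in a single gauge
   orbit, hence in the lift of [Z 0]. *)
have WS k y : (k < h)%N -> subtorus k.+1 y0 y -> W k.+1 y.
  rewrite leq_eqVlt /W => /orP[/eqP->|->] //; rewrite ltnn subnn.
  by move=> [s sT <-]; have [g gT ->] := subtorus_gauge y0O sT; apply: lift_set_gauge.
suff : (h + n <= h + e)%N by rewrite leq_add2l.
apply: (chain_bound N0_gt0 _ T_gen (W := W) (P := P)).
- by move=> t' [].
- by rewrite /W; exists y0; case: ifP => // _; apply: subtorus_refl.
- move=> y; rewrite /W ltnNge leq_addr /= => -[[t' Tt' ->] _]; exists t' => //.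
- move=> k kle; rewrite /W; case: ltnP => hk; first exact: subtorus_prime.
  have le : (k - h <= n)%N by lia.
  by apply: lift_set_prime; [exact: ZO | have [] := Zcl _ le].
- move=> k y klt; case: (ltnP k h) => hk.
    by rewrite {1}/W hk => /(subtorusS (ltn_addr _ hk)); apply: WS.
  rewrite /W ltnNge hk ltnNge (leqW hk) /= subSn // => -[yO Zy]; split=> //.
  have lt : (k - h < n)%N by lia.
  by have [ZZ _] := ZS _ lt; apply: ZZ.
- move=> k klt; rewrite /W /P; case: ltnP => hk.
    by have [] := binomial_subtorus (ltn_addr _ hk) y0O.
  have lt : (k - h < n)%N by lia.
  by have [] := pE _ lt.
- move=> k klt; rewrite /P; case: ltnP => hk.
    have [_ [y yS yN0] /(_ y (WS _ _ hk yS))] := binomial_subtorus (ltn_addr _ hk) y0O.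
    exact: yN0.
  have lt : (k - h < n)%N by lia.
  rewrite /W ltnNge (leqW hk) /= subSn //.
  by have [] := pE _ lt.
Qed.

Theorem orbit_krull_dim : T_M_orbit_dim theta x e.
Proof. by split; [exact: orbit_irred_chain | exact: orbit_chain_bound]. Qed.

End KrullDimension.

End OrbitDimension.

(** * Rational bases of cocharacters *)

Lemma common_denominator (J : finType) (z : J -> rat) :
  exists2 d : nat, (0 < d)%N & exists w : J -> int, forall j, (w j)%:~R = d%:R * z j.
Proof.
pose d := \prod_j denq (z j); have d0 : 0 < d by apply: prodr_gt0 => j _; rewrite denq_gt0.
exists `|d|%N; first by rewrite absz_gt0 gt_eqF.
exists (fun j => numq (z j) * \prod_(i | i != j) denq (z i)) => j.
have -> : `|d|%N%:R = d%:~R :> rat by rewrite -[in RHS](gtz0_abs d0).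
rewrite /d [in RHS](bigD1 j) //= !intrM -[X in _ = _ * X]divq_num_den.
by rewrite mulrAC [_%:~R * (_ / _)]mulrC divfK ?intr_eq0 ?denq_neq0.
Qed.

Section Orthogonality.
Variable F : fieldType.

(** Fredholm alternative. It is the solvability criterion by which weights on edges and potentials
    are found below. *)
Lemma kermx_orthogonal (m n : nat) (A : 'M[F]_(m, n)) (v : 'cV_m) :
  kermx A *m v = 0 -> exists z, v = A *m z.
Proof.
move=> Av; suff /submxP[z zE] : (v^T <= A^T)%MS.
  by exists z^T; rewrite -[v]trmxK zE trmx_mul !trmxK.
rewrite submxE -trmx_eq0 trmx_mul trmxK; apply/eqP.
have : ((cokermx A^T)^T <= kermx A)%MS.
  by apply/sub_kermxP; rewrite -[A in _ *m A]trmxK -trmx_mul mulmx_coker trmx0.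
by case/submxP=> y ->; rewrite -mulmxA Av mulmx0.
Qed.

Lemma kermx_line (m n : nat) (A : 'M[F]_(m, n)) (u : 'rV_m) : u != 0 ->
  u *m A = 0 -> (forall v : 'rV_m, v *m A = 0 -> exists c, v = c *: u) ->
  (\rank A).+1 = m.
Proof.
move=> u0 uA uspan; have : (kermx A == u)%MS.
  apply/andP; split; last exact/sub_kermxP.
  by apply/rV_subP=> v /sub_kermxP/uspan[c ->]; apply: scalemx_sub.
move/eqmx_rank; rewrite mxrank_ker rank_rV u0 /=.
by have := rank_leq_row A; lia.
Qed.

End Orthogonality.

Section FinTypeMatrices.
Variables (E V : finType).

Definition frow (f : E -> rat) : 'rV[rat]_#|E| := \row_j f (enum_val j).

Definition fmatrix (f : E -> V -> rat) : 'M[rat]_(#|E|, #|V|) :=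
  \matrix_(i, j) f (enum_val i) (enum_val j).

Definition row_fun (v : 'rV[rat]_#|E|) (a : E) : rat := v 0 (enum_rank a).

Lemma frowK f : row_fun (frow f) =1 f.
Proof. by move=> a; rewrite /row_fun mxE enum_rankK. Qed.

Lemma row_funK v : frow (row_fun v) = v.
Proof. by apply/rowP=> j; rewrite mxE /row_fun enum_valK. Qed.

Lemma sum_enum_rank (f : 'I_#|E| -> rat) : \sum_j f j = \sum_a f (enum_rank a).
Proof. by rewrite (reindex _ (onW_bij _ (@enum_rank_bij E))). Qed.

Lemma sum_enum_val (f : E -> rat) : \sum_a f a = \sum_(j < #|E|) f (enum_val j).
Proof. by rewrite (reindex _ (onW_bij _ (@enum_val_bij E))). Qed.

End FinTypeMatrices.

Section CocharacterBasis.
Variables (E V Q : finType) (k : V -> E -> int) (d : Q -> E -> int) (S : pred E).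
Hypothesis dk : forall q F, \sum_a d q a * k F a = 0.

Definition constraint_mx := fmatrix (fun a F => (k F a)%:~R).
Definition gauge_mx := fmatrix (fun q a => (d q a)%:~R).
Definition support_mx := fmatrix (fun a b : E => ((a == b) && S a)%:R).

Let K := constraint_mx.
Let H := gauge_mx *m support_mx.
Let T := kermx K *m support_mx.

Lemma mul_support_mx n (A : 'M_(n, #|E|)) i (a : E) :
  (A *m support_mx) i (enum_rank a) = A i (enum_rank a) *+ S a.
Proof.
rewrite mxE sum_enum_rank (bigD1 a) //= !mxE !enum_rankK eqxx mulr_natr.
by rewrite big1 ?addr0 // => b /negPf ba; rewrite mxE !enum_rankK ba mulr0.
Qed.

Lemma support_mx_mul n (A : 'M_(#|E|, n)) i (a : E) :
  (support_mx *m A) (enum_rank a) i = A (enum_rank a) i *+ S a.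
Proof.
rewrite mxE sum_enum_rank (bigD1 a) //= !mxE !enum_rankK eqxx mulr_natl.
by rewrite big1 ?addr0 // => b /negPf ba; rewrite mxE !enum_rankK eq_sym ba mul0r.
Qed.

Lemma support_mx_idem : support_mx *m support_mx = support_mx.
Proof.
apply/matrixP=> i j; rewrite -[j]enum_valK mul_support_mx !mxE enum_rankK.
by case: eqP => [->|]; case: (S _); rewrite ?mul0rn //= andbF.
Qed.

Lemma gauge_sub_torus : (H <= T)%MS.
Proof.
apply: submxMr; apply/sub_kermxP/matrixP=> i j; rewrite !mxE.
rewrite -[RHS](_ : (\sum_a d (enum_val i) a * k (enum_val j) a)%:~R = 0 :> rat).
  rewrite rmorph_sum /= [RHS]sum_enum_val; apply: eq_bigr => a _.
  by rewrite !mxE rmorphM.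
by rewrite dk.
Qed.

(** [T] consists of the cocharacters cut down to the support, [H] of those that come from changes of
    basis. A basis of [H] is completed to one of [T], a dual basis is taken, and denominators are
    cleared, which produces [D] and [N0]. *)
Lemma cocharacter_basis : exists (e : nat) (m nu : nat -> {ffun E -> int})
    (D : nat -> int) (N0 : nat) (h := \rank H) (cc : E -> 'I_(h + e) -> int)
    (z : E -> V -> int),
  [/\ (h + e)%N = \rank T,
      forall i F, (i < h + e)%N -> \sum_a k F a * nu i a = 0,
      forall i j, (i < h + e)%N -> (j < h + e)%N ->
        \sum_a m i a * nu j a = D i *+ (i == j),
      forall i, (i < h + e)%N -> D i != 0 &
      forall i a, ~~ S a -> m i a = 0] /\
  [/\ forall i, (i < h)%N -> exists c : {ffun Q -> int},
        forall a, S a -> nu i a = \sum_q c q * d q a,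
      forall i q, (h <= i < h + e)%N -> \sum_a m i a * d q a = 0,
      (0 < N0)%N &
      forall a b, S a -> N0%:Z *+ (a == b) =
        \sum_i cc a i * m i b + \sum_F z a F * k F b].
Proof.
pose h := \rank H; pose e := \rank (T :\: H)%MS.
pose P := col_mx (row_base H) (row_base (T :\: H)%MS).
have PT : (P :=: T)%MS.
  apply/eqmxP/andP; split.
    by rewrite col_mx_sub !eq_row_base gauge_sub_torus diffmxSl.
  rewrite -(addsmx_diff_cap_eq T H) -addsmxE.
  rewrite addsmxC addsmxS ?eq_row_base //; exact: capmxSr.
have he : (h + e)%N = \rank T.
  by rewrite -(mxrank_cap_compl T H) (capmx_idPr gauge_sub_torus).
have Pfree : row_free P by rewrite /row_free PT he.
have [U UE] : exists U, P = U *m kermx K *m support_mx.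
  have /submxP[U UE] : (P <= T)%MS by rewrite PT.
  by exists U; rewrite UE mulmxA.
(* The rows of [NU] lift those of [P] to vectors that satisfy the constraints on all of [E]. The
   columns of [M] are dual to the rows of [P]; cutting them down to [S] keeps the duality, as [P] is
   supported there. *)
have [M0 M0E] := row_freeP Pfree; pose M := support_mx *m M0; pose NU := U *m kermx K.
have SM : support_mx *m M = M by rewrite mulmxA support_mx_idem.
have PS : P *m support_mx = P by rewrite UE -!mulmxA support_mx_idem.
have PM : P *m M = 1%:M by rewrite mulmxA PS.
have NUM : NU *m M = 1%:M by rewrite mulmxA -UE.
have NUK : NU *m K = 0 by rewrite -mulmxA mulmx_ker mulmx0.
have [W WE] : exists W, H = W *m usubmx P.
  by rewrite col_mxKu; apply/submxP; rewrite eq_row_base.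
have HM : gauge_mx *m M = W *m row_mx 1%:M 0.
  rewrite mulmxA; transitivity (W *m usubmx P *m M0); first by congr (_ *m M0).
  by rewrite -mulmxA mul_usub_mx M0E scalar_mx_block block_mxEv col_mxKu.
have [c cE] : exists c, usubmx P = c *m H.
  by rewrite col_mxKu; apply/submxP; rewrite eq_row_base.
(* A unit vector minus its expansion in the dual basis is supported on [S] and orthogonal to [T],
   hence a combination of the constraints. *)
have gen (a : E) : S a -> exists z, delta_mx (enum_rank a) 0 =
    M *m (P *m delta_mx (enum_rank a) 0) + K *m z :> 'cV_#|E|.
  move=> Sa; pose v := delta_mx (enum_rank a) 0 - M *m (P *m delta_mx (enum_rank a) 0)
    : 'cV_#|E|.
  have vS : support_mx *m v = v.
    rewrite mulmxBr [support_mx *m (M *m _)]mulmxA SM; congr (_ - _).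
    apply/colP=> j; rewrite -[j]enum_valK support_mx_mul !mxE eqxx andbT.
    case: eqP => [/enum_rank_inj ->|_]; last by rewrite mul0rn.
    by rewrite Sa.
  have [|z zE] := @kermx_orthogonal _ _ _ K v.
    rewrite -vS mulmxA -/T; have /submxP[Y ->] : (T <= P)%MS by rewrite PT.
    by rewrite -mulmxA mulmxBr [P *m (M *m _)]mulmxA PM mul1mx subrr mulmx0.
  by exists z; rewrite -zE addrC subrK.
have /boolp.choice[z zE] (a : E) : exists z, S a -> delta_mx (enum_rank a) 0 =
    M *m (P *m delta_mx (enum_rank a) 0) + K *m z :> 'cV_#|E|.
  by have [/gen[z ?]|_] := boolP (S a); [exists z | exists 0].
have [dn dn0 [wn wnE]] := common_denominator
  (fun u : 'I_(h + e) * E + 'I_h * Q => match u with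
     | inl (i, a) => NU i (enum_rank a) | inr (i, q) => c i (enum_rank q) end).
have [dm dm0 [wm wmE]] := common_denominator
  (fun u : 'I_(h + e) * E => M (enum_rank u.2) u.1).
have [dz dz0 [wz wzE]] := common_denominator
  (fun u : E * 'I_(h + e) + E * V => match u with
     | inl (a, i) => P i (enum_rank a) | inr (a, F) => z a (enum_rank F) 0 end).
pose ext (f : 'I_(h + e) -> {ffun E -> int}) i := if insub i is Some i' then f i' else 0.
have extE f (i : 'I_(h + e)) : ext f i = f i by rewrite /ext valK.
pose m := ext (fun i => [ffun a => wm (i, a)]).
pose nu := ext (fun i => [ffun a => wn (inl (i, a))]).
have mE (i : 'I_(h + e)) a : (m i a)%:~R = dm%:R * M (enum_rank a) i.
  by rewrite /m extE ffunE wmE.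
have nuE (i : 'I_(h + e)) a : (nu i a)%:~R = dn%:R * NU i (enum_rank a).
  by rewrite /nu extE ffunE wnE.
exists e, m, nu, (fun=> (dm * dn)%:Z), (dm * dz)%N, (fun a i => wz (inl (a, i))),
  (fun a F => dm%:Z * wz (inr (a, F))).
have MS a i : ~~ S a -> M (enum_rank a) i = 0.
  by move=> Sa; rewrite support_mx_mul (negPf Sa) mulr0n.
split; split=> //.
- move=> i F lti; pose i' := Ordinal lti; apply: (intr_inj (R := rat)).
  rewrite rmorph_sum /=.
  transitivity (dn%:R * (NU *m K) i' (enum_rank F)); last by rewrite NUK mxE mulr0.
  rewrite mxE mulr_sumr [RHS]sum_enum_rank; apply: eq_bigr => a _.
  by rewrite rmorphM /= (nuE i') mulrCA [_ * K _ _]mulrC !mxE !enum_rankK mulrA.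
- move=> i j lti ltj; pose i' := Ordinal lti; pose j' := Ordinal ltj.
  apply: (intr_inj (R := rat)); rewrite rmorph_sum /= rmorphMn /=.
  transitivity (dm%:R * dn%:R * (NU *m M) j' i').
    rewrite mxE mulr_sumr [RHS]sum_enum_rank; apply: eq_bigr => a _.
    by rewrite rmorphM /= (nuE j') (mE i') mulrACA [M _ _ * _]mulrC.
  by rewrite NUM mxE -natrM eq_sym mulr_natr.
- by move=> i _; rewrite -lt0n muln_gt0 dm0.
- move=> i a Sa; rewrite /m /ext; case: insubP => [i' _ _|]; last by rewrite ffunE.
  by apply: (intr_inj (R := rat)); rewrite ffunE wmE MS // mulr0.
- move=> i lti; pose i' := lshift e (Ordinal lti).
  exists [ffun q => wn (inr (Ordinal lti, q))] => a Sa.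
  apply: (intr_inj (R := rat)); rewrite (nuE i') rmorph_sum /=.
  have -> : NU i' (enum_rank a) = (c *m H) (Ordinal lti) (enum_rank a).
    rewrite -cE [in RHS]mxE UE -/NU mul_support_mx Sa mulr1n //.
  rewrite mulmxA mul_support_mx Sa mulr1n mxE mulr_sumr [LHS]sum_enum_rank.
  apply: eq_bigr => q _; rewrite rmorphM /= ffunE wnE mulrA; congr (_ * _).
  by rewrite mxE !enum_rankK.
- move=> i q /andP[hi lti]; pose i' := Ordinal lti.
  apply: (intr_inj (R := rat)); rewrite rmorph_sum /=.
  transitivity (dm%:R * (gauge_mx *m M) (enum_rank q) i').
    rewrite mxE mulr_sumr [RHS]sum_enum_rank; apply: eq_bigr => a _.
    by rewrite rmorphM /= (mE i') -mulrA [M _ _ * _]mulrC !mxE !enum_rankK.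
  have lte : (i - h < e)%N by lia.
  have -> : i' = rshift h (Ordinal lte) by apply: val_inj => /=; lia.
  by rewrite HM mul_mx_row mulmx0 row_mxEr mxE mulr0.
- by rewrite muln_gt0 dm0.
- move=> a b Sa; apply: (intr_inj (R := rat)).
  rewrite rmorphMn rmorphD !rmorph_sum /=.
  have /colP/(_ (enum_rank b)) := zE a Sa.
  rewrite -colE !mxE eqxx andbT (inj_eq enum_rank_inj) => bE.
  transitivity ((dm * dz)%:R * (b == a)%:R : rat); first by rewrite eq_sym mulr_natr.
  rewrite bE mulrDr natrM; congr (_ + _); rewrite mulr_sumr.
    apply: eq_bigr => i _; rewrite rmorphM /= wzE mE [col _ _ _ _]mxE.
    by rewrite mulrACA mulrC.
  rewrite [LHS]sum_enum_rank; apply: eq_bigr => F _.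
  rewrite !rmorphM /= wzE mxE !enum_rankK.
  by rewrite -!mulrA [X in _ = _ * (_ * X)]mulrC.
Qed.


End CocharacterBasis.

(** * Relations and stability *)

Lemma porbit_fconnect (T : finType) (p : {perm T}) a b :
  (b \in porbit p a) = fconnect p a b.
Proof.
apply/porbitP/idP => [[i ->]|/iter_findex <-]; first by rewrite permX fconnect_iter.
by exists (findex p a b); rewrite permX.
Qed.

Section Relations.
Variable G : brane_tiling.
Implicit Types (a b : edge G) (F : vert G).

Lemma white_ofP a (w : white G) : (a \in val w) = (white_of a == w).
Proof.
have /imsetP[b _ wE] := valP w; rewrite -(inj_eq val_inj) /= wE.
by rewrite -eq_porbit_mem.
Qed.

Lemma black_ofP a (w : black G) : (a \in val w) = (black_of a == w).
Proof.
have /imsetP[b _ wE] := valP w; rewrite -(inj_eq val_inj) /= wE.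
by rewrite -eq_porbit_mem.
Qed.

Lemma white_of_nextw a : white_of (nextw G a) = white_of a.
Proof. by apply: val_inj; rewrite /= (porbit_perm _ 1). Qed.

Lemma black_of_nextb a : black_of (nextb G a) = black_of a.
Proof. by apply: val_inj; rewrite /= (porbit_perm _ 1). Qed.

Lemma src_nextb a : src (nextb G a) = tgt a.
Proof.
apply: val_inj => /=.
by rewrite -[in RHS](porbit_perm _ 1) expg1 permM permK.
Qed.

Lemma mem_edges_at a F : (a \in edges_at F) =
  match F with inl w => white_of a == w | inr b => black_of a == b end.
Proof. by case: F => F /=; rewrite ?white_ofP ?black_ofP. Qed.

(* The arrows of a face of Q form an oriented cycle. *)
Lemma sum_tgt_src (A : zmodType) F (f : Q0 G -> A) :
  \sum_(a in edges_at F) f (tgt a) = \sum_(a in edges_at F) f (src a).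
Proof.
case: F => F.
  rewrite [RHS](reindex_inj (@perm_inj _ (nextw G))) /=.
  by apply: eq_bigl => a; rewrite !white_ofP white_of_nextw.
rewrite [RHS](reindex_inj (@perm_inj _ (nextb G))) /=.
apply: eq_big => [a|a _]; first by rewrite !black_ofP black_of_nextb.
by rewrite src_nextb.
Qed.

Lemma sum_d2 (A : nzRingType) F (f : edge G -> A) :
  \sum_a (d2 F a)%:~R * f a = \sum_(a in edges_at F) f a.
Proof.
rewrite [RHS]big_mkcond; apply: eq_bigr => a _.
by rewrite ffunE; case: (a \in _); rewrite ?mul1r ?mul0r.
Qed.

Lemma sum_d2_d1 F q : \sum_a d2 F a * d1 a q = 0.
Proof.
transitivity (\sum_a (d2 F a)%:~R * d1 a q).
  by apply: eq_bigr => a _; rewrite intz.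
rewrite sum_d2; under eq_bigr do rewrite ffunE.
by rewrite sumrB (sum_tgt_src F (fun i => (q == i)%:R)) subrr.
Qed.

Lemma d2B F F' a : (d2 F - d2 F') a = d2 F a - d2 F' a.
Proof. by rewrite !ffunE. Qed.

Lemma sum_d2B_d1 F F' q : \sum_a (d2 F - d2 F') a * d1 a q = 0.
Proof.
under eq_bigr do rewrite d2B mulrBl.
by rewrite sumrB !sum_d2_d1 subrr.
Qed.

Section Words.
Variables (R : realType) (x : {ffun edge G -> R[i]}).

Lemma cycle_word_uniq (p : {perm edge G}) s : uniq (cycle_word p s).
Proof.
by rewrite /cycle_word; case: pickP => // a _; apply: orbit_uniq.
Qed.

Lemma mem_cycle_word (p : {perm edge G}) s : s \in porbits p -> cycle_word p s =i s.
Proof.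
case/imsetP=> a _ -> b; rewrite /cycle_word; case: pickP => [c|/(_ a)]; last first.
  by rewrite porbit_id.
by rewrite -eq_porbit_mem => /eqP <-; rewrite porbit_fconnect fconnect_orbit.
Qed.

Lemma word_deriv_sum (A : zmodType) a (u : seq (edge G)) (g : seq (edge G) -> A) :
  uniq u -> \sum_(v <- word_deriv a u) g v =
    if a \in u then g (behead (rot (index a u) u)) else 0.
Proof.
move=> uu; rewrite /word_deriv big_map big_filter.
case: ifP => au; last first.
  rewrite big_seq_cond big1 // => k /andP[]; rewrite mem_iota /= => klt /eqP ak.
  by rewrite -ak mem_nth in au.
rewrite big_mkcond (bigD1_seq (index a u)) ?iota_uniq ?mem_iota ?index_mem //=.
rewrite nth_index // eqxx big_seq_cond big1 ?addr0 // => k /andP[].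
rewrite mem_iota /= => klt /eqP kN; case: eqP => // ak; case: kN.
by rewrite -ak index_uniq.
Qed.

Lemma word_val_deriv a (u : seq (edge G)) : uniq u -> a \in u ->
  word_val x (behead (rot (index a u) u)) = \prod_(b in u | b != a) x b.
Proof.
move=> uu au; have rotE := rot_index au.
have ru : uniq (rot (index a u) u) by rewrite rot_uniq.
rewrite rotE in ru *; rewrite /word_val /= big_uniq /=; last by case/andP: ru.
apply: eq_bigl => b; have : (b \in rot (index a u) u) = (b \in u) by rewrite mem_rot.
rewrite rotE in_cons; case: (eqVneq b a) => [->|ba /= ->]; last by rewrite andbT.
by rewrite andbF; case/andP: ru => /negPf.
Qed.

Lemma cycle_word_deriv_sum (p : {perm edge G}) (c : int) a :
  \sum_(F : {s | s \in porbits p})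
     \sum_(v <- word_deriv a (cycle_word p (val F))) c%:~R * word_val x v =
  c%:~R * \prod_(b in porbit p a | b != a) x b.
Proof.
pose F0 : {s | s \in porbits p} := Sub (porbit p a) (imset_f _ isT).
have deriv (F : {s | s \in porbits p}) :
    \sum_(v <- word_deriv a (cycle_word p (val F))) c%:~R * word_val x v =
    if a \in val F then c%:~R * \prod_(b in val F | b != a) x b else 0.
  rewrite word_deriv_sum ?cycle_word_uniq // (mem_cycle_word (valP F)).
  case: ifP => // aF; rewrite word_val_deriv ?cycle_word_uniq //; last first.
    by rewrite (mem_cycle_word (valP F)).
  by congr (_ * _); apply: eq_bigl => b; rewrite (mem_cycle_word (valP F)).
rewrite (eq_bigr _ (fun s _ => deriv s)) (bigD1 F0) //= [X in _ + X]big1 => [|F FF0]; last first.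
  case aF: (a \in val F) => //; case/eqP: FF0; apply: val_inj => /=.
  by have /imsetP[b _ FE] := valP F; move: aF; rewrite FE -eq_porbit_mem => /eqP ->.
by rewrite porbit_id addr0.
Qed.

(** Every arrow lies on exactly two faces of [Q], once on each and with opposite signs, so each
    cyclic derivative is a difference of two monomials. *)
Lemma satisfies_relationsP : satisfies_relations x <-> forall a,
  \prod_(b in edges_at (inl (white_of a)) | b != a) x b =
  \prod_(b in edges_at (inr (black_of a)) | b != a) x b.
Proof.
suff sumE a : \sum_(cu <- cyclic_deriv a (potential G)) cu.1%:~R * word_val x cu.2 =
    \prod_(b in edges_at (inl (white_of a)) | b != a) x b -
    \prod_(b in edges_at (inr (black_of a)) | b != a) x b.
  split=> rel a; last by rewrite sumE rel subrr.
  by apply/eqP; rewrite -subr_eq0 -sumE; apply/eqP.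
rewrite /cyclic_deriv big_allpairs_dep big_cat /= !big_image /=.
rewrite (cycle_word_deriv_sum (nextw G) 1 a) (cycle_word_deriv_sum (nextb G) (-1) a).
by rewrite mul1r mulN1r.
Qed.

End Words.

End Relations.

Section Connectivity.
Variable G : brane_tiling.
Implicit Types (a b : edge G) (F : vert G).

Lemma white_of_surj (w : white G) : exists a, white_of a = w.
Proof. by have /imsetP[a _ wE] := valP w; exists a; apply: val_inj. Qed.

Lemma black_of_surj (w : black G) : exists a, black_of a = w.
Proof. by have /imsetP[a _ wE] := valP w; exists a; apply: val_inj. Qed.

Lemma some_edge : exists a : edge G, true.
Proof. by have /card_gt0P[a _] := tiling_nonempty G; exists a. Qed.

Lemma vert_const (A : eqType) (u : vert G -> A) :
  (forall a, u (inl (white_of a)) = u (inr (black_of a))) ->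
  forall F F', u F = u F'.
Proof.
move=> uE; have [a0 _] := some_edge.
have wconst a : u (inl (white_of a)) = u (inl (white_of a0)).
  apply/eqP; rewrite -[_ == _]/(a \in [pred b | u (inl (white_of b)) == u (inl (white_of a0))]).
  rewrite -(closed_connect _ (tiling_connected a0 a)) ?inE //.
  move=> b c /orP[] /eqP ->; rewrite !inE ?white_of_nextw //.
  by rewrite !uE black_of_nextb.
have ac F : u F = u (inl (white_of a0)).
  case: F => w; first by have [a <-] := white_of_surj w.
  by have [a <-] := black_of_surj w; rewrite -uE.
by move=> F F'; rewrite !ac.
Qed.

End Connectivity.

Section Semistability.
Variables (R : realType) (G : brane_tiling).
Local Notation C := R[i].
Local Notation point := {ffun edge G -> C}.
Implicit Types (x t : point) (theta : {ffun Q0 G -> int}).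

Lemma character_d2 t F : character t (d2 F) = \prod_(a in edges_at F) t a.
Proof.
rewrite [RHS]big_mkcond; apply: eq_bigr => a _; rewrite ffunE.
by case: (a \in _).
Qed.

Lemma T_Lambda_semistable theta t x :
  T_Lambda t -> semistable theta x -> semistable theta (act t x).
Proof.
move=> [tT t1] [/satisfies_relationsP xrel xss]; split.
  apply/satisfies_relationsP => a; under eq_bigr do rewrite ffunE.
  under [RHS]eq_bigr do rewrite ffunE.
  (* After multiplication by [t a] both products are values of [t] on faces of [Q], and these agree
     on [T_Lambda]. *)
  rewrite !big_split xrel; congr (_ * _); apply: (mulfI (tT a)).
  have tD F : a \in edges_at F ->
      t a * \prod_(b in edges_at F | b != a) t b = character t (d2 F).
    by move=> aF; rewrite character_d2 [RHS](bigD1 a).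
  rewrite !tD ?mem_edges_at //.
  have := t1 (inl (white_of a)) (inr (black_of a)); rewrite characterB //.
  by move/divr1_eq.
move=> Y Ysub; apply: xss => a v vY; have := Ysub a v vY.
by rewrite ffunE -scalerA => /(memvZ (t a)^-1); rewrite scalerK.
Qed.

Lemma T_Lambda_gauge (g : {ffun Q0 G -> C}) :
  torus g -> T_Lambda (monomial_map (@d1 G) g).
Proof.
move=> gT; split=> [|F F']; first exact: torus_monomial_map.
rewrite character_monomial_map // -[RHS](character0 g); congr character.
by apply/ffunP=> q; rewrite ffunE sum_d2B_d1 ffunE.
Qed.

(** A level set [U] of [f] and its complement both carry subrepresentations. By semistability
    [theta] is nonnegative on both, and the two values add up to 0 because [theta] lies in [B]; so
    [theta] vanishes on the indicator of [U], which genericity excludes. *)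
Lemma support_connected theta x (A : eqType) (f : Q0 G -> A) :
  in_B theta -> generic theta -> semistable theta x ->
  (forall a, x a != 0 -> f (src a) = f (tgt a)) -> forall i j, f i = f j.
Proof.
move=> thB thgen [_ xss] fE i j; apply/eqP; apply: contraT => fij.
pose ind (U : pred (Q0 G)) : {ffun Q0 G -> int} := [ffun k => (U k)%:R].
have ind_ge0 (U : pred (Q0 G)) : (forall a, x a != 0 -> U (src a) = U (tgt a)) ->
    (exists k, U k) -> (exists k, ~~ U k) -> 0 <= dot theta (ind U).
  move=> UE [k1 k1U] [k0 k0U].
  pose Y k : {vspace C^o} := if U k then fullv else 0%VS.
  have C1 : \dim (fullv : {vspace C^o}) = 1%N by rewrite dimvf.
  have -> : ind U = dimv Y.
    by apply/ffunP=> k; rewrite !ffunE /Y; case: (U k); rewrite ?C1 ?dimv0.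
  apply: xss; last 2 first.
  - by exists k1; rewrite /Y k1U => /(congr1 (fun V : {vspace C^o} => \dim V)); rewrite C1 dimv0.
  - by exists k0; rewrite /Y (negPf k0U) => /(congr1 (fun V : {vspace C^o} => \dim V)); rewrite C1 dimv0.
  move=> a v; rewrite /Y; have [->|/UE ->] := eqVneq (x a) 0.
    by rewrite scale0r mem0v.
  by case: ifP => // _; rewrite ?memvf // !memv0 => /eqP ->; rewrite scaler0.
pose U k := f k == f i.
have Ui : U i by rewrite /U. have Uj : ~~ U j by rewrite /U eq_sym.
have UE a : x a != 0 -> U (src a) = U (tgt a) by move/fE; rewrite /U => ->.
have th1 : 0 <= dot theta (ind U) by apply: ind_ge0 => //; [exists i|exists j].
have th2 : 0 <= dot theta (ind (predC U)).
  apply: ind_ge0; [by move=> a /UE /= -> | by exists j | by exists i; rewrite /= Ui].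
have th0 : dot theta (ind U) + dot theta (ind (predC U)) = 0.
  rewrite -[RHS]thB /dot -big_split; apply: eq_bigr => k _ /=.
  by rewrite !ffunE -mulrDr /=; case: (U k); rewrite ?addr0 ?add0r mulr1.
have dU0 : dot theta (ind U) = 0 by move: th1 th2 th0; lia.
suff : dot theta (ind U) <> 0 by [].
by apply: thgen => [k|/ffunP/(_ i)|/ffunP/(_ j)];
  rewrite !ffunE /= ?Ui ?(negPf Uj) //; case: (U k).
Qed.

End Semistability.

(** * Ranks of spaces of edge weights *)

Section Supports.
Variable E : finType.
Implicit Types (P : pred E) (v : 'rV[rat]_#|E|).

Lemma row_fun_eq v w : row_fun v =1 row_fun w -> v = w.
Proof. by move=> vw; rewrite -[v]row_funK -[w]row_funK; apply/rowP=> j; rewrite !mxE vw. Qed.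

Lemma row_funD v w a : row_fun (v + w) a = row_fun v a + row_fun w a.
Proof. by rewrite /row_fun mxE. Qed.

Lemma row_funZ c v a : row_fun (c *: v) a = c * row_fun v a.
Proof. by rewrite /row_fun mxE. Qed.

Lemma sub_support_mx P v : (v <= support_mx P)%MS <-> forall a, ~~ P a -> row_fun v a = 0.
Proof.
split=> [/submxP[w ->] a Pa|v0].
  by rewrite /row_fun mul_support_mx (negPf Pa).
apply/submxP; exists v; apply: row_fun_eq => a.
rewrite /row_fun mul_support_mx; case Pa: (P a) => //.
by rewrite mulr0n; apply: v0; rewrite Pa.
Qed.

Lemma kermx_support_mx P : (kermx (support_mx P) :=: support_mx (predC P))%MS.
Proof.
apply/eqmxP/andP; split; apply/rV_subP=> v.
  move/sub_kermxP=> vP; apply/sub_support_mx => a /= /negPn Pa.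
  by have /rowP/(_ (enum_rank a)) := vP; rewrite mul_support_mx Pa mxE.
move/sub_support_mx=> vP; apply/sub_kermxP/row_fun_eq => a.
rewrite /row_fun mul_support_mx [RHS]mxE; case Pa: (P a) => //.
by rewrite mulr1n; apply: vP; rewrite /= Pa.
Qed.

Lemma rank_support_mx P : \rank (support_mx P) = #|P|.
Proof.
pose J : 'M[rat]_(#|P|, #|E|) := \matrix_(i, j) (enum_val i == enum_val j)%:R.
have JS : J *m support_mx P = J.
  apply/matrixP=> i j; rewrite -[j]enum_valK mul_support_mx mxE enum_rankK.
  case: eqP => [<-|_]; last by rewrite mul0rn.
  by have := enum_valP i; rewrite unfold_in => ->.
have SJ : support_mx P = J^T *m J.
  apply/matrixP=> i j; rewrite !mxE; case: (boolP (P (enum_val i))) => Pi; last first.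
    rewrite andbF big1 // => k _; rewrite !mxE; case: eqP => [ki|]; last by rewrite mul0r.
    by move: Pi; rewrite -ki; have := enum_valP k; rewrite unfold_in => ->.
  rewrite (bigD1 (enum_rank_in Pi (enum_val i))) //= !mxE enum_rankK_in // eqxx mul1r andbT.
  rewrite big1 ?addr0 // => k ki; rewrite !mxE; case: eqP => [kE|]; last by rewrite mul0r.
  by case/eqP: ki; apply: enum_val_inj; rewrite enum_rankK_in.
have JJ : J *m J^T = 1%:M.
  apply/matrixP=> i j; rewrite !mxE (bigD1 (enum_rank (enum_val i))) //= !mxE.
  rewrite enum_rankK eqxx mul1r big1 ?addr0 => [|k ki].
    by rewrite (inj_eq enum_val_inj) eq_sym.
  rewrite !mxE; case: eqP => [kE|]; last by rewrite mul0r.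
  by case/eqP: ki; rewrite kE enum_valK.
have Jfree : row_free J by apply/row_freeP; exists J^T.
have rJ : \rank J = #|P| by apply/eqP.
apply/eqP; rewrite eqn_leq -{1}rJ -{2}rJ SJ mxrankM_maxr /= -SJ -{1}JS.
exact: mxrankM_maxr.
Qed.

Lemma rank_adds_row n (A : 'M[rat]_(n, #|E|)) v :
  ~~ (v <= A)%MS -> \rank (A + v)%MS = (\rank A).+1.
Proof.
move=> vA; have [v0|v0] := eqVneq v 0; first by rewrite v0 sub0mx in vA.
have := mxrank_sum_cap A v; rewrite rank_rV v0.
suff -> : (A :&: v)%MS = 0 by rewrite mxrank0; lia.
apply/eqP; rewrite -submx0; apply/rV_subP=> u.
rewrite sub_capmx => /andP[uA /sub_rVP[c uE]].
rewrite submx0 uE; have [->|c0] := eqVneq c 0; first by rewrite scale0r.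
by case/negP: vA; move/(scalemx_sub c^-1): uA; rewrite uE scalerA mulVf // scale1r.
Qed.

End Supports.

(** * Incidence matrix and homology of subgraphs *)

Section Incidence.
Variable G : brane_tiling.
Local Notation E := (edge G).
Local Notation V := (vert G).
Implicit Types (a : E) (F : V) (L : {set E}).

Definition incidence_mx := fmatrix (fun (a : E) (F : V) => (a \in edges_at F)%:R).
Local Notation N := incidence_mx.

Definition vertex_sum (f : E -> rat) F := \sum_(a in edges_at F) f a.

Lemma mul_incidence_mx v F : (v *m N) 0 (enum_rank F) = vertex_sum (row_fun v) F.
Proof.
rewrite mxE sum_enum_rank /vertex_sum [RHS]big_mkcond; apply: eq_bigr => a _.
by rewrite mxE !enum_rankK /row_fun; case: (a \in _); rewrite ?mulr1 ?mulr0.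
Qed.

Lemma sum_ends (u : V -> rat) a :
  \sum_F (a \in edges_at F)%:R * u F = u (inl (white_of a)) + u (inr (black_of a)).
Proof.
rewrite big_sumType; congr (_ + _).
  rewrite (bigD1 (white_of a)) // mem_edges_at eqxx mul1r big1 => [|w].
    exact: addr0.
  by rewrite mem_edges_at eq_sym => /negPf ->; rewrite mul0r.
rewrite (bigD1 (black_of a)) // mem_edges_at eqxx mul1r big1 => [|w].
  exact: addr0.
by rewrite mem_edges_at eq_sym => /negPf ->; rewrite mul0r.
Qed.

Lemma mul_incidence_tr (u : 'rV[rat]_#|{: V}|) a : (u *m N^T) 0 (enum_rank a) =
  row_fun u (inl (white_of a)) + row_fun u (inr (black_of a)).
Proof.
rewrite -sum_ends mxE [LHS]sum_enum_rank; apply: eq_bigr => F _.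
by rewrite mxE mxE !enum_rankK mulrC.
Qed.

Lemma kermx_incidence v : (v <= kermx N)%MS <-> forall F, vertex_sum (row_fun v) F = 0.
Proof.
split=> [/sub_kermxP/rowP vN F|v0]; first by rewrite -mul_incidence_mx vN mxE.
by apply/sub_kermxP/row_fun_eq => F; rewrite /row_fun mul_incidence_mx v0 mxE.
Qed.

(** With edges oriented from white to black, these weights are the cycles of the subgraph [L]: the
    row space is its first rational homology. *)
Definition flow_mx L := (support_mx (mem L) :&: kermx N)%MS.

Lemma sub_flow_mx L v : (v <= flow_mx L)%MS <->
  (forall a, a \notin L -> row_fun v a = 0) /\ forall F, vertex_sum (row_fun v) F = 0.
Proof.
rewrite sub_capmx; split=> [/andP[/sub_support_mx vL /kermx_incidence vN]|[vL vN]].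
  by split.
by apply/andP; split; [apply/sub_support_mx | apply/kermx_incidence].
Qed.

Definition touched L F := L :&: edges_at F != finset.set0.

(** After a change of sign at black vertices, these are the functions constant on the components of
    the graph with all vertices of [G] and edge set [L], that is, its zeroth cohomology. The formula
    [rank_flow_mx] is then the Euler characteristic. *)
Definition alternating_mx L := kermx (support_mx (mem L) *m N)^T.

Lemma sub_alternating_mx L (u : 'rV[rat]_#|{: V}|) : (u <= alternating_mx L)%MS <->
  forall a, a \in L -> row_fun u (inl (white_of a)) + row_fun u (inr (black_of a)) = 0.
Proof.
have uE a : (u *m (support_mx (mem L) *m N)^T) 0 (enum_rank a) =
    (row_fun u (inl (white_of a)) + row_fun u (inr (black_of a))) *+ (a \in L).
  rewrite -mul_incidence_tr mxE [in RHS]mxE -sumrMnl; apply: eq_bigr => F _.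
  by rewrite mxE support_mx_mul [in RHS]mxE mulrnAr.
split=> [/sub_kermxP/rowP u0 a aL|u0].
  by have := uE a; rewrite u0 mxE aL.
apply/sub_kermxP/row_fun_eq => a; rewrite /row_fun uE mxE.
by case: (boolP (a \in L)) => // /u0 ->.
Qed.

Lemma rank_flow_mx L :
  (\rank (flow_mx L) + #|{: V}| = #|L| + \rank (alternating_mx L))%N.
Proof.
have := mxrank_mul_ker (support_mx (mem L)) N.
rewrite rank_support_mx mxrank_ker mxrank_tr -/(flow_mx L).
have := rank_leq_col (support_mx (mem L) *m N).
by move=> rV rL; rewrite -[#|L|]rL [RHS]addnAC subnKC // addnC.
Qed.

Lemma touchedP L F : reflect (exists2 a, a \in L & a \in edges_at F) (touched L F).
Proof.
apply: (iffP (set0Pn _)) => [[a]|[a aL aF]]; first by rewrite inE => /andP[]; exists a.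
by exists a; rewrite inE aL.
Qed.

Lemma touched_ends L a : a \in L ->
  touched L (inl (white_of a)) /\ touched L (inr (black_of a)).
Proof. by move=> aL; split; apply/touchedP; exists a; rewrite ?mem_edges_at. Qed.

Definition sign_row : 'rV[rat]_#|{: V}| := frow (fun F : V => if F is inl _ then 1 else -1).

Lemma sum_rank_adds_sign L a : a \in L ->
  \rank (support_mx (predC (touched L)) + sign_row)%MS = (#|predC (touched L)|).+1.
Proof.
move=> aL; rewrite rank_adds_row ?rank_support_mx //.
apply/negP => /sub_support_mx /(_ (inl (white_of a))).
rewrite frowK /= negbK => /(_ (touched_ends aL).1)/eqP.
by rewrite oner_eq0.
Qed.

Lemma sign_sub_alternating L :
  (support_mx (predC (touched L)) + sign_row <= alternating_mx L)%MS.
Proof.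
rewrite addsmx_sub; apply/andP; split.
  apply/rV_subP=> u /sub_support_mx u0; apply/sub_alternating_mx => a aL.
  by have [wL bL] := touched_ends aL; rewrite !u0 ?addr0 /= ?negbK.
by apply/sub_alternating_mx => a aL; rewrite !frowK subrr.
Qed.

Lemma rank_flow_ge L a : a \in L -> (#|L| < \rank (flow_mx L) + #|touched L|)%N.
Proof.
move=> aL; have := mxrankS (sign_sub_alternating L); rewrite (sum_rank_adds_sign aL).
move: (rank_flow_mx L); move: (\rank (alternating_mx L)) => r.
rewrite -(cardC (touched L)) => rE rgt.
by rewrite -(ltn_add2r #|predC (touched L)|) -addnA rE ltn_add2l.
Qed.

(** Connectedness leaves one alternating function on the touched vertices, up to scalars; each
    untouched vertex adds one more and cancels in the Euler characteristic. *)
Lemma rank_flow_connected L a : a \in L ->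
  (forall f : V -> rat, (forall b, b \in L -> f (inl (white_of b)) = f (inr (black_of b))) ->
     forall F F', touched L F -> touched L F' -> f F = f F') ->
  (\rank (flow_mx L) + #|touched L| = #|L|.+1)%N.
Proof.
move=> aL Lconn.
have altE : (alternating_mx L :=: support_mx (predC (touched L)) + sign_row)%MS.
  apply/eqmxP; rewrite sign_sub_alternating andbT; apply/rV_subP=> u /sub_alternating_mx u0.
  pose f F := row_fun u F * row_fun sign_row F.
  have fE b : b \in L -> f (inl (white_of b)) = f (inr (black_of b)).
    by move=> /u0/eqP; rewrite addr_eq0 => /eqP uE; rewrite /f !frowK uE mulrN1 mulr1.
  pose c := f (inl (white_of a)).
  rewrite -(subrK (c *: sign_row) u) addmx_sub_adds ?scalemx_sub //.
  apply/sub_support_mx => F /= /negbNE FL.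
  have cE : c = f F by apply: (Lconn f fE) => //; have [] := touched_ends aL.
  rewrite /row_fun mxE mxE [X in _ - X]mxE -/(row_fun u F) -/(row_fun sign_row F) cE /f.
  have -> : row_fun u F * row_fun sign_row F * row_fun sign_row F = row_fun u F.
    by rewrite -mulrA frowK; case: (F) => ?; rewrite ?mulrNN !mulr1.
  exact: subrr.
have := rank_flow_mx L; rewrite altE (sum_rank_adds_sign aL).
rewrite -(cardC (touched L)) => rE; apply/eqP.
by rewrite -(eqn_add2r #|predC (touched L)|) -addnA rE addSnnS.
Qed.

(* The rational cocharacters of T_Lambda. *)
Definition balanced_mx (F0 : V) := kermx (constraint_mx (fun F a => (d2 F - d2 F0) a)).

Lemma sub_balanced_mx F0 v : (v <= balanced_mx F0)%MS <->
  forall F, vertex_sum (row_fun v) F = vertex_sum (row_fun v) F0.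
Proof.
have vE F : (v *m constraint_mx (fun F a => (d2 F - d2 F0) a)) 0 (enum_rank F) =
    vertex_sum (row_fun v) F - vertex_sum (row_fun v) F0.
  rewrite mxE sum_enum_rank /vertex_sum -!sum_d2 -sumrB; apply: eq_bigr => a _.
  by rewrite mxE !enum_rankK d2B rmorphB /= mulrBr ![_ * row_fun _ _]mulrC.
split=> [/sub_kermxP/rowP v0 F|v0].
  by apply/eqP; rewrite -subr_eq0 -vE v0 mxE.
by apply/sub_kermxP/row_fun_eq => F; rewrite /row_fun vE v0 subrr mxE.
Qed.

Lemma vertex_sumB (v w : 'rV[rat]_#|E|) (c : rat) F :
  vertex_sum (row_fun (v - c *: w)) F =
  vertex_sum (row_fun v) F - c * vertex_sum (row_fun w) F.
Proof. by rewrite /vertex_sum mulr_sumr -sumrB; apply: eq_bigr => a _; rewrite /row_fun !mxE. Qed.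

Lemma rank_balanced F0 (U : 'M[rat]_#|E|) (w : 'rV_#|E|) : (w <= U)%MS ->
  (forall F, vertex_sum (row_fun w) F = 1) ->
  \rank (balanced_mx F0 :&: U)%MS = (\rank (U :&: kermx N)%MS).+1.
Proof.
move=> wU w1; rewrite -(@rank_adds_row _ _ _ w); last first.
  rewrite sub_capmx; apply/negP => /andP[_ /kermx_incidence/(_ F0)/eqP].
  by rewrite w1 oner_eq0.
apply/eqmx_rank/andP; split.
  apply/rV_subP=> v; rewrite sub_capmx => /andP[/sub_balanced_mx vF vU].
  rewrite -(subrK (vertex_sum (row_fun v) F0 *: w) v).
  rewrite addmx_sub_adds ?scalemx_sub // sub_capmx addmx_sub ?eqmx_opp ?scalemx_sub //=.
  by apply/kermx_incidence => F; rewrite vertex_sumB w1 mulr1 vF subrr.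
rewrite addsmx_sub; apply/andP; split; last first.
  by rewrite sub_capmx wU andbT; apply/sub_balanced_mx => F; rewrite !w1.
rewrite sub_capmx capmxSl andbT; apply/rV_subP=> v.
rewrite sub_capmx => /andP[_ /kermx_incidence v0].
by apply/sub_balanced_mx => F; rewrite !v0.
Qed.

(** By the Fredholm alternative the constant 1 is a vector of vertex sums as soon as it is
    orthogonal to all alternating functions on [L]. *)
Lemma balanced_solution L :
  (forall u : V -> rat, (forall a, a \in L -> u (inl (white_of a)) + u (inr (black_of a)) = 0) ->
     \sum_F u F = 0) ->
  exists2 w : 'rV_#|E|, (w <= support_mx (mem L))%MS &
    forall F, vertex_sum (row_fun w) F = 1.
Proof.
move=> usum; have [|z zE] := @kermx_orthogonal _ _ _ (support_mx (mem L) *m N)^T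
    (const_mx 1 : 'cV_#|{: V}|).
  apply/row_matrixP=> i; rewrite row_mul row0.
  have : (row i (alternating_mx L) <= alternating_mx L)%MS by exact: row_sub.
  move/sub_alternating_mx/usum => s0; apply/rowP=> j.
  rewrite mxE [RHS]mxE -[RHS]s0 [LHS]sum_enum_rank.
  by apply: eq_bigr => F _; rewrite [const_mx _ _ _]mxE mulr1.
exists (z^T *m support_mx (mem L)) => [|F]; first exact: submxMl.
by rewrite -mul_incidence_mx -mulmxA -[_ *m N]trmxK -trmx_mul -zE !mxE.
Qed.

End Incidence.

(** * Rank of the torus acting on an orbit *)

Section OrbitRank.
Variables (R : realType) (G : brane_tiling).
Local Notation C := R[i].
Local Notation E := (edge G).

Lemma big_white (T : Type) (idx : T) (op : Monoid.com_law idx) (f : E -> T) :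
  \big[op/idx]_(w : white G) \big[op/idx]_(a in edges_at (inl w)) f a = \big[op/idx]_a f a.
Proof.
rewrite [RHS](partition_big (@white_of G) xpredT) //=.
by apply: eq_bigr => w _; apply: eq_bigl => a; rewrite white_ofP.
Qed.

Lemma big_black (T : Type) (idx : T) (op : Monoid.com_law idx) (f : E -> T) :
  \big[op/idx]_(w : black G) \big[op/idx]_(a in edges_at (inr w)) f a = \big[op/idx]_a f a.
Proof.
rewrite [RHS](partition_big (@black_of G) xpredT) //=.
by apply: eq_bigr => w _; apply: eq_bigl => a; rewrite black_ofP.
Qed.

(** The total R-charge is twice the number of white vertices and also twice the number of black
    ones. *)
Lemma card_white_black : geometrically_consistent G R -> #|{: white G}| = #|{: black G}|.
Proof.
move=> [r [_ r2 _]]; have := big_white +%R r; rewrite -(big_black +%R r).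
rewrite (eq_bigr _ (fun w _ => r2 (inl w))) (eq_bigr _ (fun b _ => r2 (inr b))).
rewrite !sumr_const -[LHS]mulr_natr -[RHS]mulr_natr => /mulfI.
by rewrite pnatr_eq0 => /(_ isT) /eqP; rewrite eqr_nat => /eqP.
Qed.

Lemma card_edges : #|E| = (#|{: vert G}| + #|{: Q0 G}|)%N.
Proof. by rewrite card_sum !card_sig -(tiling_euler G). Qed.

Lemma sum_vert (u : vert G -> rat) (c : rat) : geometrically_consistent G R ->
  (forall w, u (inl w) = c) -> (forall b, u (inr b) = - c) -> \sum_F u F = 0.
Proof.
move=> HG uw ub; rewrite big_sumType /= (eq_bigr _ (fun w _ => uw w)).
rewrite (eq_bigr _ (fun b _ => ub b)) !sumr_const (card_white_black HG) mulNrn.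
exact: subrr.
Qed.

(** The first Betti number of the connected graph [G], rewritten by the Euler characteristic of the
    torus. *)
Lemma rank_all_flows : \rank (flow_mx [set: E]) = (#|{: Q0 G}|).+1.
Proof.
have [a _] := some_edge G.
have tT F : touched [set: E] F.
  case: F => w; first by have [b <-] := white_of_surj w; have [] := touched_ends (in_setT b).
  by have [b <-] := black_of_surj w; have [] := touched_ends (in_setT b).
have tC : #|touched [set: E]| = #|{: vert G}|.
  by apply: eq_card => F; transitivity true; [exact: tT | by []].
have : (\rank (flow_mx [set: E]) + #|touched [set: E]| = #|[set: E]|.+1)%N.
  apply: (rank_flow_connected (in_setT a)) => f fE F F' _ _.
  by apply: vert_const => b; apply: fE.
rewrite tC cardsT; move: (\rank _) => r; rewrite card_edges addnC -addnS => /eqP.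
by rewrite eqn_add2l => /eqP.
Qed.

Lemma rank_all_balanced F0 : geometrically_consistent G R ->
  \rank (@balanced_mx G F0) = (#|{: Q0 G}|).+2.
Proof.
move=> HG; have [w wT w1] : exists2 w : 'rV_#|E|,
    (w <= support_mx (mem [set: E]))%MS & forall F, vertex_sum (row_fun w) F = 1.
  apply: balanced_solution => u u0.
  pose f F := match F with inl _ => u F | inr _ => - u F end.
  have fconst : forall F F', f F = f F'.
    by apply: vert_const => a; apply/eqP; rewrite -addr_eq0; apply/eqP/u0; rewrite inE.
  have [a _] := some_edge G; pose c := u (inl (white_of a)).
  apply: (@sum_vert u c HG) => [w|b]; first exact: fconst (inl _) (inl _).
  by apply/eqP; rewrite -eqr_oppLR; apply/eqP/(fconst (inr _) (inl _)).
rewrite -rank_all_flows -(rank_balanced F0 wT w1).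
apply: eqmx_rank; rewrite capmxSl sub_capmx submx_refl submx_full //.
by rewrite /row_full rank_support_mx -cardsT.
Qed.

Lemma mul_gauge_mx (S : pred E) (u : 'rV_#|{: Q0 G}|) a :
  (u *m (gauge_mx (fun q a => d1 a q) *m support_mx S)) 0 (enum_rank a) =
  (row_fun u (tgt a) - row_fun u (src a)) *+ S a.
Proof.
rewrite mulmxA mul_support_mx mxE sum_enum_rank; congr (_ *+ _).
transitivity (\sum_q row_fun u q * ((q == tgt a)%:R - (q == src a)%:R)).
  by apply: eq_bigr => q _; rewrite mxE !enum_rankK ffunE rmorphB /= !rmorph_nat.
under eq_bigr do rewrite mulrBr.
have delta i : \sum_q row_fun u q * (q == i)%:R = row_fun u i.
  by rewrite (bigD1 i) //= eqxx mulr1 big1 ?addr0 // => q /negPf ->; rewrite mulr0.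
by rewrite sumrB !delta.
Qed.

Lemma rank_gauge (S : pred E) :
  (forall f : Q0 G -> rat, (forall a, S a -> f (src a) = f (tgt a)) -> forall i j, f i = f j) ->
  (\rank (gauge_mx (fun q a => d1 a q) *m support_mx S)).+1 = #|{: Q0 G}|.
Proof.
move=> Sconn; have [a0 _] := some_edge G.
apply: (@kermx_line _ _ _ _ (frow (fun=> 1))).
- apply/eqP => /rowP/(_ (enum_rank (src a0))); rewrite !mxE => /eqP.
  by rewrite oner_eq0.
- by apply: row_fun_eq => a; rewrite /row_fun mul_gauge_mx !frowK subrr mul0rn mxE.
move=> v v0; exists (row_fun v (src a0)); apply: row_fun_eq => i.
rewrite [RHS]mxE -/(row_fun _ i) frowK mulr1; apply: Sconn => a Sa.
have := mul_gauge_mx S v a; rewrite v0 mxE Sa mulr1n => /esym/eqP.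
by rewrite subr_eq0 => /eqP.
Qed.

(** The rank of [T_Lambda] is [|Q0| + 2]; cocharacters supported on the cosupport fix [x]; and the
    gauge group acts with rank [|Q0| - 1], its kernel being the constants since the support is
    connected. The 3 is the difference of the first and the last rank. *)
Theorem orbit_dim_cosupport (theta : {ffun Q0 G -> int}) (x : {ffun E -> C}) F0 :
  geometrically_consistent G R -> in_B theta -> generic theta -> semistable theta x ->
  exists2 e, T_M_orbit_dim theta x e &
    (e + \rank (balanced_mx F0 :&: support_mx (mem (cosupport x)))%MS)%N = 3.
Proof.
move=> HG thB thgen x_ss; pose k F a := (d2 F - d2 F0 : {ffun E -> int}) a.
pose S : pred E := fun a => x a != 0.
pose h := \rank (gauge_mx (fun q (a : E) => d1 a q) *m support_mx S).
have dk q F : \sum_a d1 a q * k F a = 0.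
  by rewrite -[RHS](sum_d2B_d1 F F0 q); apply: eq_bigr => a _; apply: mulrC.
have [e [m [nu [D [N0 [cc [z [[he nuk mnu D0 mS] [nug mg N00 gen]]]]]]]]] :=
  @cocharacter_basis _ _ _ k (fun q a => d1 a q) S dk.
exists e.
  apply: (@orbit_krull_dim R G theta x _ _ _ _ e m nu D _ _ _ _ _ _ N0 cc) => //.
  - by move=> t y; apply: T_Lambda_semistable.
  - exact: T_Lambda_gauge.
  - move=> i F F' lti; transitivity (\sum_a k F a * nu i a - \sum_a k F' a * nu i a); last first.
      by rewrite !nuk // subrr.
    rewrite -sumrB; apply: eq_bigr => a _; rewrite /k !d2B -mulrBl; congr (_ * _).
    by rewrite opprB addrA subrK.
  - by move=> i a xa; apply: mS; rewrite /S xa eqxx.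
  - move=> t a [tT t1] xa.
    pose N0a : {ffun E -> int} := [ffun b => N0%:Z *+ (a == b)].
    have -> : t a ^+ N0 = character t N0a.
      rewrite /character (bigD1 a) //= ffunE eqxx mulr1n.
      by rewrite big1 ?mulr1 // => b /negPf ba; rewrite ffunE eq_sym ba mulr0n.
    have -> : N0a = \sum_(i < h + e) m i *~ cc a i + \sum_F (d2 F - d2 F0) *~ z a F.
      apply/ffunP=> b; rewrite ffunE gen // ffunE !sum_ffunE; congr (_ + _).
        by apply: eq_bigr => i _; rewrite ffunMzE mulrzz mulrC.
      by apply: eq_bigr => F _; rewrite ffunMzE mulrzz mulrC.
    rewrite characterD // !character_sum //.
    under eq_bigr do rewrite characterMz.
    rewrite [X in _ * X]big1 ?mulr1 // => F _.
    by rewrite characterMz t1 exp1rz.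
have hH := rank_gauge (S := S) (fun f fE => support_connected thB thgen x_ss fE).
have rT := mxrank_mul_ker (kermx (constraint_mx k)) (support_mx S).
have I_eq : (kermx (support_mx S) :=: support_mx (mem (cosupport x)))%MS.
  apply: eqmx_trans (kermx_support_mx S) _.
  suff -> : support_mx (predC S) = support_mx (mem (cosupport x)) by [].
  by apply/matrixP=> i j; rewrite !mxE /= negbK inE.
have rcap : \rank (kermx (constraint_mx k) :&: kermx (support_mx S))%MS =
    \rank (balanced_mx F0 :&: support_mx (mem (cosupport x)))%MS.
  have [-> _] := cap_eqmx (eqmx_refl (kermx (constraint_mx k))) I_eq.
  by [].
have := rank_all_balanced F0 HG; rewrite -hH -/h /balanced_mx => rB.
move: rT; rewrite rcap rB -he -/h -addnA -addn3 => /eqP.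
by rewrite eqn_add2l => /eqP.
Qed.

End OrbitRank.

(** * Intersection form *)

(** The obstructions to solving this difference equation are the functions constant on the cycles of
    [s], against which [f] sums to 0. *)
Lemma perm_potential (T : finType) (s : {perm T}) (f : T -> rat) :
  (forall a, \sum_(b in porbit s a) f b = 0) ->
  exists q : T -> rat, forall a, q (s a) = q a + f a.
Proof.
move=> f0; pose A := fmatrix (fun a b : T => (b == s a)%:R - (b == a)%:R : rat).
have AE a b : A (enum_rank a) (enum_rank b) = (b == s a)%:R - (b == a)%:R.
  by rewrite mxE !enum_rankK.
have uA (u : 'rV[rat]_#|T|) b : (u *m A) 0 (enum_rank b) = row_fun u (s^-1%g b) - row_fun u b.
  rewrite mxE sum_enum_rank.
  under eq_bigr do rewrite AE mulrBr.
  rewrite sumrB (bigD1 (s^-1%g b)) //= permKV eqxx mulr1 big1 => [|a /negPf ab].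
    rewrite addr0 (bigD1 b) //= eqxx mulr1 big1 ?addr0 // => a /negPf ab.
    by rewrite eq_sym ab mulr0.
  by rewrite -(inj_eq (@perm_inj _ s^-1%g)) permK eq_sym ab mulr0.
have [|z zE] := @kermx_orthogonal _ _ _ A (frow f)^T.
  apply/row_matrixP=> i; rewrite row_mul row0; set u := row i _.
  have /sub_kermxP uA0 : (u <= kermx A)%MS by exact: row_sub.
  have us b : row_fun u (s b) = row_fun u b.
    have := uA u (s b); rewrite uA0 mxE permK => /esym/eqP.
    by rewrite subr_eq0 => /eqP ->.
  have uorb c b : b \in porbit s c -> row_fun u b = row_fun u c.
    case/porbitP=> k ->; elim: k => [|k IHk]; first by rewrite expg0 perm1.
    by rewrite expgSr permM us.
  apply/rowP=> j; rewrite mxE [RHS]mxE sum_enum_rank.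
  transitivity (\sum_a row_fun u a * f a).
    by apply: eq_bigr => a _; rewrite [(frow f)^T _ _]mxE [frow f _ _]mxE enum_rankK.
  rewrite (partition_big (porbit s) (mem (porbits s))) => [|a _]; last exact: imset_f.
  rewrite big1 // => X /imsetP[c _ ->].
  rewrite (eq_bigl (mem (porbit s c))) => [|a]; last by rewrite eq_porbit_mem.
  transitivity (row_fun u c * \sum_(b in porbit s c) f b); last by rewrite f0 mulr0.
  by rewrite mulr_sumr; apply: eq_bigr => b /uorb ->.
exists (row_fun z^T) => a.
have -> : f a = \sum_b A (enum_rank a) (enum_rank b) * z (enum_rank b) 0.
  transitivity ((frow f)^T (enum_rank a) 0); first by rewrite mxE mxE enum_rankK.
  by rewrite zE mxE sum_enum_rank.
under eq_bigr do rewrite AE mulrBl.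
rewrite sumrB (bigD1 (s a)) //= eqxx mul1r big1 ?addr0 => [|b /negPf ->]; last by rewrite mul0r.
rewrite (bigD1 a) //= eqxx mul1r big1 ?addr0 => [|b /negPf ->]; last by rewrite mul0r.
by rewrite /row_fun !mxE addrC subrK.
Qed.

Section Intersection.
Variable G : brane_tiling.
Local Notation E := (edge G).
Implicit Types (a b : E) (f g : E -> rat) (h : Q0 G -> rat).

Definition flow f := forall F, vertex_sum f F = 0.

Section Pairing.
Variables (f qw qb : E -> rat).
Hypotheses (qwE : forall a, qw (nextw G a) = qw a + f a)
           (qbE : forall a, qb (nextb G a) = qb a + f a).

(* [qw] and [qb] are primitives of [f] along the cycles of edges around the white
   and the black vertices; [pairing g] is the intersection number of [f] and [g]. *)
Definition pairing g := \sum_a (qw a - qb a) * g a.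

(** Summation by parts gives the same value around the white and around the black vertices, as both
    successors of an arrow start at its head. *)
Lemma pairing_coboundary h : pairing (fun a => h (tgt a) - h (src a)) = 0.
Proof.
have half (p : {perm E}) q : (forall a, q (p a) = q a + f a) ->
    (forall a, src (p a) = tgt a) ->
    \sum_a q a * (h (tgt a) - h (src a)) = - \sum_a f a * h (tgt a).
  move=> qE psrc; under eq_bigr do rewrite mulrBr.
  rewrite sumrB [X in _ - X](reindex_inj (@perm_inj _ p)) -sumrB -sumrN.
  by apply: eq_bigr => a _ /=; rewrite qE psrc mulrDl opprD addNKr.
rewrite /pairing; under eq_bigr do rewrite mulrBl.
rewrite sumrB (half (nextw G)) // (half (nextb G)) ?subrr //.
exact: src_nextb.
Qed.

(** The increments of [q ^+ 2] sum to 0 along a permutation, which expresses the sum of [q a * f a]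
    through [f] alone, equally for both colors. *)
Lemma pairing_self : pairing f = 0.
Proof.
have half (p : {perm E}) q : (forall a, q (p a) = q a + f a) ->
    \sum_a q a * f a *+ 2 = - \sum_a f a ^+ 2.
  move=> qE; have sqE : \sum_a q a ^+ 2 = \sum_a q (p a) ^+ 2.
    exact: (reindex_inj (@perm_inj _ p)).
  apply/eqP; rewrite -subr_eq0 opprK -big_split /=; apply/eqP.
  transitivity (\sum_a (q (p a) ^+ 2 - q a ^+ 2)); last by rewrite sumrB sqE subrr.
  by apply: eq_bigr => a _; rewrite qE; ring.
suff : pairing f *+ 2 = 0 by move/eqP; rewrite mulrn_eq0 => /eqP.
rewrite /pairing -sumrMnl; under eq_bigr do rewrite mulrBl mulrnBl.
by rewrite sumrB (half (nextw G)) // (half (nextb G)) // subrr.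
Qed.

(** Around a vertex where [f] vanishes its primitive is constant, and [g] has sum 0 there. *)
Lemma pairing_disjoint g : flow g ->
  (forall F, (forall a, a \in edges_at F -> f a = 0) \/
             (forall a, a \in edges_at F -> g a = 0)) ->
  pairing g = 0.
Proof.
move=> gflow fg; rewrite /pairing; under eq_bigr do rewrite mulrBl.
have orb0 (p : {perm E}) q X c : (forall a, q (p a) = q a + f a) -> X = porbit p c ->
    \sum_(a in X) g a = 0 ->
    (forall a, a \in X -> f a = 0) \/ (forall a, a \in X -> g a = 0) ->
    \sum_(a in X) q a * g a = 0.
  move=> qE XE gX [f0|g0]; last by rewrite big1 // => a /g0 ->; rewrite mulr0.
  have qX a : a \in X -> q a = q c.
    rewrite XE => /porbitP[k ->]; elim: k => [|k IHk]; first by rewrite expg0 perm1.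
    by rewrite expgSr permM qE IHk f0 ?addr0 // XE mem_porbit.
  by rewrite (eq_bigr (fun a => q c * g a)) => [|a /qX -> //]; rewrite -mulr_sumr gX mulr0.
rewrite sumrB -(big_white +%R) -(big_black +%R) !big1 ?subrr // => w _.
  have /imsetP[c _ wE] := valP w.
  exact: (orb0 (nextb G) qb _ c qbE wE (gflow (inr w)) (fg (inr w))).
have /imsetP[c _ wE] := valP w.
exact: (orb0 (nextw G) qw _ c qwE wE (gflow (inl w)) (fg (inl w))).
Qed.

(* Poincare duality. *)
Lemma pairing_nondegenerate : (forall g, flow g -> pairing g = 0) ->
  exists h, forall a, f a = h (tgt a) - h (src a).
Proof.
move=> pair0; have [|z zE] := @kermx_orthogonal _ _ _ (incidence_mx G)
    (frow (fun a => qw a - qb a))^T.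
  apply/row_matrixP=> i; rewrite row_mul row0; set v := row i _.
  have /kermx_incidence vflow : (v <= kermx (incidence_mx G))%MS by exact: row_sub.
  apply/rowP=> j; rewrite mxE [RHS]mxE -[RHS](pair0 _ vflow) [LHS]sum_enum_rank.
  by apply: eq_bigr => a _; rewrite [(frow _)^T _ _]mxE [frow _ _ _]mxE enum_rankK mulrC.
pose u F := z (enum_rank F) 0.
have qE a : qw a - qb a = u (inl (white_of a)) + u (inr (black_of a)).
  have /colP/(_ (enum_rank a)) := zE; rewrite !mxE enum_rankK => ->.
  rewrite sum_enum_rank -sum_ends; apply: eq_bigr => F _.
  by rewrite mxE !enum_rankK.
(* Shifting the primitives by constants at each vertex makes them agree. The common primitive [q] is
   invariant under [nextw^-1 * nextb], so it descends to the vertices of [Q] and gives [h]. *)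
pose q a := qw a - u (inl (white_of a)).
have q_b a : q a = qb a + u (inr (black_of a)).
  by rewrite /q -[qw a](subrK (qb a)) qE; ring.
have qw_next a : q (nextw G a) = q a + f a.
  by rewrite /q qwE white_of_nextw addrAC.
have qb_next a : q (nextb G a) = q a + f a.
  by rewrite !q_b qbE black_of_nextb addrAC.
have q_src a b : src a = src b -> q a = q b.
  move/(congr1 val)/eqP; rewrite /= eq_porbit_mem => /porbitP[k ->].
  elim: k => [|k IHk]; first by rewrite expg0 perm1.
  by rewrite expgSr permM -IHk permM qb_next -qw_next permKV.
have [a0 _] := some_edge G.
pose h i := if [pick a | src a == i] is Some a then q a else 0.
have hE a : h (src a) = q a.
  by rewrite /h; case: pickP => [b /eqP/q_src //|/(_ a)]; rewrite eqxx.
by exists h => a; rewrite hE /tgt hE qw_next addrC addKr.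
Qed.

End Pairing.

(* Two vertex-disjoint cycles on the torus have intersection number 0, so they
   cannot both be part of a symplectic basis of the first homology; hence some
   combination of them bounds, and its interior is cut off from the rest. *)
Lemma disjoint_flows (L : {set E}) f1 f2 :
  (forall h, (forall a, a \notin L -> h (src a) = h (tgt a)) -> forall i j, h i = h j) ->
  (forall a, a \notin L -> f1 a = 0) -> (forall a, a \notin L -> f2 a = 0) ->
  flow f1 -> flow f2 ->
  (forall F, (forall a, a \in edges_at F -> f1 a = 0) \/
             (forall a, a \in edges_at F -> f2 a = 0)) ->
  (forall a, f1 a = 0) \/ (forall a, f2 a = 0).
Proof.
move=> Lconn f1L f2L f1flow f2flow disj; apply: contrapT => /not_orP[f1N f2N].
(* A coboundary supported on [L] has a potential that is unchanged across all arrows outside [L],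
   hence constant. *)
have bound0 f h : (forall a, a \notin L -> f a = 0) ->
    (forall a, f a = h (tgt a) - h (src a)) -> forall a, f a = 0.
  move=> fL fE a; rewrite fE (Lconn h _ (tgt a) (src a)) ?subrr // => b /fL.
  by rewrite fE => /eqP; rewrite subr_eq0 => /eqP.
have scalarE (c : 'M[rat]_1) (w : 'rV[rat]_#|E|) : exists c', c *m w = c' *: w.
  by exists (c 0 0); rewrite {1}[c]mx11_scalar mul_scalar_mx.
pose B := gauge_mx (fun q (a : E) => d1 a q) *m support_mx (@predT E).
have BE (v : 'rV_#|E|) : (v <= B)%MS ->
    exists h, forall a, row_fun v a = h (tgt a) - h (src a).
  case/submxP=> u ->; exists (row_fun u) => a.
  by rewrite /row_fun mul_gauge_mx.
have BL (v : 'rV_#|E|) : (v <= B)%MS -> (forall a, a \notin L -> row_fun v a = 0) ->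
    forall a, row_fun v a = 0.
  by move=> /BE[h vE] vL; apply: bound0 vE.
have f1B : ~~ (frow f1 <= B)%MS.
  apply/negP => /BL f10; apply: f1N => a; rewrite -[f1 a]frowK f10 // => b.
  by rewrite frowK => /f1L.
have f2B : ~~ (frow f2 <= B + frow f1)%MS.
  apply/negP => /sub_addsmxP[[u c] /= f2E].
  have [c' cE] := scalarE c (frow f1).
  have f2f1 a : f2 a = c' * f1 a.
    have : row_fun (u *m B) a = 0.
      apply: BL; first exact: submxMl.
      move=> b bL; have := frowK f2 b; rewrite f2E cE row_funD row_funZ frowK f1L //.
      by rewrite mulr0 addr0 => ->; apply: f2L.
    by rewrite -[f2 a]frowK f2E cE row_funD row_funZ frowK => ->; rewrite add0r.
  apply: f2N => a; case: (disj (inl (white_of a))) => [f10|f20].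
    by rewrite f2f1 f10 ?mulr0 // mem_edges_at.
  by apply: f20; rewrite mem_edges_at.
(* Flows have rank [|Q0| + 1] and coboundaries [|Q0| - 1], so [f1] and [f2] supply the missing two
   dimensions. The pairing with [f1] then vanishes on every flow, which forces [f1] to be a
   coboundary. *)
have span : (kermx (incidence_mx G) <= B + frow f1 + frow f2)%MS.
  have sub : (B + frow f1 + frow f2 <= kermx (incidence_mx G))%MS.
    rewrite !addsmx_sub -!andbA; apply/and3P; split.
    - apply/rV_subP=> v /BE[h vE]; apply/kermx_incidence => F.
      rewrite /vertex_sum (eq_bigr _ (fun a _ => vE a)) sumrB.
      by rewrite (sum_tgt_src F h) subrr.
    - by apply/kermx_incidence => F; rewrite -[RHS](f1flow F); apply: eq_bigr => a _; rewrite frowK.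
    - by apply/kermx_incidence => F; rewrite -[RHS](f2flow F); apply: eq_bigr => a _; rewrite frowK.
  have rk := rank_all_flows G.
  have -> : (kermx (incidence_mx G) <= B + frow f1 + frow f2)%MS =
      (\rank (B + frow f1 + frow f2)%MS == \rank (kermx (incidence_mx G))).
    by rewrite (mxrank_leqif_sup sub).
  rewrite !rank_adds_row // (rank_gauge (S := @predT E)); last first.
    by move=> h hE; apply: Lconn => a _; apply: hE.
  rewrite -rk; apply/eqP/eqmx_rank; rewrite capmxSr sub_capmx submx_refl submx_full //.
  by rewrite /row_full rank_support_mx -cardsT.
have [qw qwE] : exists q : E -> rat, forall a, q (nextw G a) = q a + f1 a.
  by apply: perm_potential => a; have := f1flow (inl (white_of a)).
have [qb qbE] : exists q : E -> rat, forall a, q (nextb G a) = q a + f1 a.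
  by apply: perm_potential => a; have := f1flow (inr (black_of a)).
have [|h f1E] := pairing_nondegenerate qwE qbE; last exact: f1N (bound0 _ h f1L f1E).
move=> g gflow; have : (frow g <= B + frow f1 + frow f2)%MS.
  apply: submx_trans span; apply/kermx_incidence => F.
  by rewrite -[RHS](gflow F); apply: eq_bigr => a _; rewrite frowK.
case/sub_addsmxP=> -[u d2] /= gE.
have /sub_addsmxP[[u' d1'] /= uE] : (u *m (B + frow f1)%MS <= B + frow f1)%MS.
  exact: submxMl.
have [h hE] := BE (u' *m B) (submxMl _ _).
have [c1 c1E] := scalarE d1' (frow f1); have [c2 c2E] := scalarE d2 (frow f2).
transitivity (pairing qw qb (fun a => h (tgt a) - h (src a)) +
    c1 * pairing qw qb f1 + c2 * pairing qw qb f2).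
  rewrite /pairing !mulr_sumr -!big_split; apply: eq_bigr => a _ /=.
  rewrite -[g a]frowK gE uE c1E c2E !row_funD !row_funZ !frowK hE.
  by ring.
rewrite (pairing_coboundary qwE qbE) (pairing_self qwE qbE).
by rewrite (pairing_disjoint qwE qbE f2flow disj) !mulr0 !addr0.
Qed.

End Intersection.

(** * Shape of the cosupport *)

Section Cosupport.
Variables (G : brane_tiling) (I : {set edge G}).
Local Notation E := (edge G).
Implicit Types (a b c : E) (F : vert G) (L : {set E}).

Lemma share_vertexP a b :
  reflect (exists2 F, a \in edges_at F & b \in edges_at F) (share_vertex a b).
Proof.
apply: (iffP orP) => [[ab|ab]|[[w|w]]].
- by exists (inl (white_of b)); rewrite mem_edges_at.
- by exists (inr (black_of b)); rewrite mem_edges_at.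
- by rewrite !mem_edges_at => /eqP -> /eqP ->; left.
- by rewrite !mem_edges_at => /eqP -> /eqP ->; right.
Qed.

Lemma share_vertexC a b : share_vertex a b = share_vertex b a.
Proof. by rewrite /share_vertex eq_sym [X in _ || X]eq_sym. Qed.

Definition adjacent := [rel b c | [&& b \in I, c \in I & share_vertex b c]].

Lemma connect_adjacent_sym : connect_sym adjacent.
Proof.
apply: sym_connect_sym => b c /=.
by rewrite share_vertexC andbCA.
Qed.

(* The edges of [I] in big components. *)
Definition crowded : {set E} :=
  [set a in I | [exists b, [&& b \in I, b != a & share_vertex a b]]].
Local Notation J := crowded.

Hypothesis crowded_vertex : forall a F, a \in J -> a \in edges_at F ->
  exists b, [/\ b \in I, b != a & b \in edges_at F].
Hypothesis I_covers : forall F, touched I F.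
Hypothesis I_connected : forall h : Q0 G -> rat,
  (forall a, a \notin I -> h (src a) = h (tgt a)) -> forall i j, h i = h j.

Lemma crowdedP a : reflect (a \in I /\ exists b F,
  [/\ b \in I, b != a, a \in edges_at F & b \in edges_at F]) (a \in J).
Proof.
rewrite inE; apply: (iffP andP) => [[aI /existsP[b /and3P[bI ba /share_vertexP[F aF bF]]]]|].
  by split=> //; exists b, F.
case=> aI [b [F [bI ba aF bF]]]; split=> //; apply/existsP; exists b.
by rewrite bI ba; apply/share_vertexP; exists F.
Qed.

Lemma crowded_sub : J \subset I.
Proof. by apply/subsetP=> a /crowdedP[]. Qed.

Lemma crowded_share a b F : a \in J -> b \in I ->
  a \in edges_at F -> b \in edges_at F -> b \in J.
Proof.
move=> aJ bI aF bF; have [<- //|ab] := eqVneq a b.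
by apply/crowdedP; split=> //; exists a, F; split=> //; apply: (subsetP crowded_sub).
Qed.

(** For [L] inside [I]: a union of connected components of [I]. *)
Definition saturated L := forall a b F, a \in L -> b \in I ->
  a \in edges_at F -> b \in edges_at F -> b \in L.

Lemma crowded_saturated : saturated J.
Proof. by move=> a b F; apply: crowded_share. Qed.

Lemma connect_adjacent_sub L a b : saturated L -> L \subset I -> a \in L ->
  connect adjacent a b -> b \in L.
Proof.
move=> Lsat LI aL ab; rewrite -(closed_connect _ ab) //.
have half c d : adjacent c d -> c \in L -> d \in L.
  by case/and3P=> _ dI /share_vertexP[F cF dF] cL; apply: Lsat cL dI cF dF.
move=> c d cd; apply/idP/idP; first exact: half cd.
by apply: half; move: cd; rewrite /= share_vertexC andbCA.
Qed.

Lemma saturated_support : saturated I.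
Proof. by []. Qed.

Lemma component_saturated a : a \in I -> saturated (finset (connect adjacent a)).
Proof.
move=> aI b c F; rewrite !inE => ab cI bF cF; apply: (connect_trans ab).
apply: connect1; rewrite /= cI (connect_adjacent_sub saturated_support _ aI ab) //=.
by apply/share_vertexP; exists F.
Qed.

Lemma component_crowded a : a \in J -> finset (connect adjacent a) \subset J.
Proof.
move=> aJ; apply/subsetP=> b; rewrite inE.
exact: connect_adjacent_sub crowded_saturated crowded_sub aJ.
Qed.

Lemma touched_valence L F : touched L F = (0 < valence L F)%N.
Proof. by rewrite /touched /valence card_gt0. Qed.

Lemma valence_ge2 L F : saturated L -> L \subset J ->
  (2 * touched L F <= valence L F)%N.
Proof.
move=> Lsat LJ; case: touchedP => // -[a aL aF].
have [b [bI ba bF]] := crowded_vertex (subsetP LJ _ aL) aF.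
have <- : #|[set a; b]| = (2 * true)%N by rewrite cards2 eq_sym ba.
apply/subset_leq_card/subsetP => c; rewrite !inE => /orP[]/eqP->.
  by rewrite aL.
by rewrite bF (Lsat a b F).
Qed.

Lemma sum_valence_white L : (\sum_(w : white G) valence L (inl w))%N = #|L|.
Proof.
rewrite -[RHS]sum1_card [RHS]big_mkcond -(big_white addn); apply: eq_bigr => w _.
by rewrite /valence -sum1_card -big_mkcondr; apply: eq_bigl => a; rewrite inE andbC.
Qed.

Lemma sum_valence_black L : (\sum_(b : black G) valence L (inr b))%N = #|L|.
Proof.
rewrite -[RHS]sum1_card [RHS]big_mkcond -(big_black addn); apply: eq_bigr => w _.
by rewrite /valence -sum1_card -big_mkcondr; apply: eq_bigl => a; rewrite inE andbC.
Qed.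

Definition touched_white L := (\sum_(w : white G) touched L (inl w))%N.
Definition touched_black L := (\sum_(b : black G) touched L (inr b))%N.

Lemma card_touched L : #|touched L| = (touched_white L + touched_black L)%N.
Proof.
by rewrite -sum1_card big_mkcond big_sumType /=; congr (_ + _)%N;
  apply: eq_bigr => w _; rewrite unfold_in; case: touched.
Qed.

(** As all valences are at least 2, [L] touches at most [#|L|] vertices, so its Euler characteristic
    is at most 0 and it contains a cycle. *)
Lemma flow_exists L a : saturated L -> L \subset J -> a \in L ->
  exists f : E -> rat, [/\ forall b, b \notin L -> f b = 0, flow f & exists b, f b != 0].
Proof.
move=> Lsat LJ aL; have le_w : (2 * touched_white L <= #|L|)%N.
  rewrite -(sum_valence_white L) /touched_white big_distrr /=.
  by apply: leq_sum => w _; apply: valence_ge2.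
have le_b : (2 * touched_black L <= #|L|)%N.
  rewrite -(sum_valence_black L) /touched_black big_distrr /=.
  by apply: leq_sum => w _; apply: valence_ge2.
have: flow_mx L != 0.
  rewrite -mxrank_eq0 -lt0n; have := rank_flow_ge aL; rewrite card_touched.
  by move: (\rank _) => r; lia.
case/rowV0Pn=> v /sub_flow_mx[vL vflow] v0; exists (row_fun v); split=> //.
apply/existsP; rewrite -negb_forall; apply: contra v0 => /forallP v0.
by apply/eqP/row_fun_eq => b; rewrite (eqP (v0 b)) /row_fun mxE.
Qed.

Lemma crowded_connected a b : a \in J -> b \in J -> connect adjacent a b.
Proof.
move=> aJ bJ; apply: contraT => nab.
pose A := finset (connect adjacent a); pose B := finset (connect adjacent b).
have [aI bI] := (subsetP crowded_sub _ aJ, subsetP crowded_sub _ bJ).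
have [aA bB] : a \in A /\ b \in B by rewrite !inE !connect0.
have [f1 [f1A f1flow [c1 f1c]]] := flow_exists (component_saturated aI)
  (component_crowded aJ) aA.
have [f2 [f2B f2flow [c2 f2c]]] := flow_exists (component_saturated bI)
  (component_crowded bJ) bB.
have notI L c : L \subset J -> c \notin I -> c \notin L.
  by move=> LJ; apply: contra => /(subsetP LJ)/(subsetP crowded_sub).
have [|||f10|f20] := disjoint_flows I_connected _ _ f1flow f2flow _.
- by move=> c /(notI _ _ (component_crowded aJ)); apply: f1A.
- by move=> c /(notI _ _ (component_crowded bJ)); apply: f2B.
- move=> F; case: (boolP (touched A F)) => [/touchedP[c cA cF]|nAF].
    right=> d dF; apply: f2B; apply: contra nab; rewrite inE => bd.
    have dI : d \in I := subsetP crowded_sub _ (connect_adjacent_sub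
      crowded_saturated crowded_sub bJ bd).
    have := component_saturated aI cA dI cF dF; rewrite inE => ad.
    by apply: connect_trans ad _; rewrite connect_adjacent_sym.
  by left=> d dF; apply: f1A; apply: contra nAF => dA; apply/touchedP; exists d.
- by rewrite f10 eqxx in f1c.
- by rewrite f20 eqxx in f2c.
Qed.

Lemma big_componentP C : big_component I C <-> J != finset.set0 /\ C = J.
Proof.
have compE a : a \in J -> finset (connect adjacent a) = J.
  move=> aJ; apply/eqP; rewrite eqEsubset component_crowded //=.
  by apply/subsetP=> b bJ; rewrite inE crowded_connected.
split=> [[[a aI CE] C1]|[/set0Pn[a aJ] ->]].
  suff aJ : a \in J by split; [apply/set0Pn; exists a | rewrite CE compE].
  apply: contraLR C1 => aJ; rewrite CE -leqNgt -(cards1 a).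
  have a_sat : saturated [set a].
    move=> b c F; rewrite !inE => /eqP -> cI aF cF; apply: contraNT aJ => ca.
    by apply/crowdedP; split=> //; exists c, F.
  apply/subset_leq_card/subsetP => b; rewrite inE.
  by apply: connect_adjacent_sub => //; rewrite ?sub1set // inE.
split; first by exists a; [exact: subsetP crowded_sub _ aJ | rewrite compE].
move/crowdedP: (aJ) => [aI [b [F [bI ba aF bF]]]].
apply/card_gt1P; exists a, b; split=> //; last by rewrite eq_sym.
exact: crowded_share aJ bI aF bF.
Qed.

(** An edge of [I] outside [J] is the only edge of [I] at its endpoints, so a flow vanishes on
    it. *)
Lemma rank_flow_crowded : \rank (flow_mx I) = \rank (flow_mx J).
Proof.
apply/eqmx_rank/andP; split; apply/rV_subP=> v /sub_flow_mx[v0 vflow];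
  apply/sub_flow_mx; split=> // a aN; last first.
  by apply: v0; apply: contra aN => /(subsetP crowded_sub).
have [aI|/v0 //] := boolP (a \in I).
have aF : a \in edges_at (inl (white_of a)) by rewrite mem_edges_at.
rewrite -(vflow (inl (white_of a))) /vertex_sum (bigD1 a) //= big1 ?addr0 // => b.
case/andP=> bF ba; apply: v0; apply: contra aN => bI.
by apply/crowdedP; split=> //; exists b, (inl (white_of a)).
Qed.

Lemma valence_isolated F : (valence (I :\: J) F + touched J F = 1)%N.
Proof.
case: (touchedP J F) => [[a aJ aF]|nJ].
  rewrite addn1; congr _.+1; apply/eqP; rewrite cards_eq0; apply/eqP/setP => b.
  rewrite in_setI in_setD in_set0; apply/negP => /andP[/andP[bJ bI] bF].
  by case/negP: bJ; apply: crowded_share aJ bI aF bF.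
have /touchedP[a aI aF] := I_covers F; rewrite addn0 -(cards1 a); apply: eq_card => b.
rewrite in_setI in_setD in_set1; apply/idP/eqP => [/andP[/andP[bJ bI] bF]|->].
  apply/eqP; apply: contraT => ba; case: nJ; exists b => //.
  by apply/crowdedP; split=> //; exists a, F; rewrite eq_sym.
by rewrite aI aF !andbT; apply/negP => aJ; apply: nJ; exists a.
Qed.

Lemma touched_white_crowded : (#|I :\: J| + touched_white J = #|{: white G}|)%N.
Proof.
rewrite -sum_valence_white -big_split -sum1_card.
by apply: eq_bigr => w _; apply: valence_isolated.
Qed.

Hypothesis white_black : #|{: white G}| = #|{: black G}|.

(** The isolated edges match the white vertices off [J] with the black vertices off [J]. *)
Lemma touched_black_crowded : touched_black J = touched_white J.
Proof.
apply/eqP; rewrite -(eqn_add2l #|I :\: J|) touched_white_crowded white_black.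
rewrite -sum_valence_black -big_split -sum1_card; apply/eqP.
by apply: eq_bigr => w _; apply: valence_isolated.
Qed.

Lemma crowded_const (A : eqType) (u : vert G -> A) :
  (forall a, a \in J -> u (inl (white_of a)) = u (inr (black_of a))) ->
  forall F F', touched J F -> touched J F' -> u F = u F'.
Proof.
move=> uE; pose v a := u (inl (white_of a)).
have uv a F : a \in J -> a \in edges_at F -> u F = v a.
  by rewrite mem_edges_at; case: F => w aJ /eqP <-; rewrite /v ?uE.
move=> F F' /touchedP[a aJ aF] /touchedP[b bJ bF']; rewrite (uv a) // (uv b) //.
pose B := [set c in J | v c == v b].
have BE c : (c \in B) = (c \in J) && (v c == v b) by rewrite /B in_set.
have Bsat : saturated B.
  move=> c d H; rewrite !BE => /andP[cJ /eqP cE] dI cH dH.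
  have dJ := crowded_share cJ dI cH dH.
  by rewrite dJ -(uv d H) // (uv c H) // cE eqxx.
have BI : B \subset I by apply/subsetP=> c; rewrite BE => /andP[/(subsetP crowded_sub)].
have bB : b \in B by rewrite BE bJ eqxx.
have := connect_adjacent_sub Bsat BI bB (crowded_connected bJ aJ).
by rewrite BE => /andP[_ /eqP].
Qed.

(** Beyond the flows there is one weight on [I] with all vertex sums 1. It exists because an
    alternating function on [I] has total 0: on [J] it is a multiple of the sign function, whose
    total is 0 by [white_black], and off [J] the remainder cancels in pairs along the isolated
    edges. *)
Lemma rank_balanced_support F0 :
  \rank (balanced_mx F0 :&: support_mx (mem I))%MS = (\rank (flow_mx J)).+1.
Proof.
have [|w wI w1] := @balanced_solution G I; last first.
  by rewrite (rank_balanced F0 wI w1) -rank_flow_crowded.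
move=> u u0; pose sg F : rat := if F is inl _ then 1 else -1.
have [k kE] : exists k : rat, forall F, touched J F -> u F = sg F * k.
  case: (pickP (mem J)) => [a /= aJ|noJ]; last first.
    by exists 0 => F /touchedP[a aJ]; have := noJ a; rewrite /= aJ.
  exists (u (inl (white_of a))) => F FJ.
  have fE b : b \in J -> sg (inl (white_of b)) * u (inl (white_of b)) =
      sg (inr (black_of b)) * u (inr (black_of b)).
    move=> /(subsetP crowded_sub)/u0/eqP; rewrite addr_eq0 => /eqP ->.
    by rewrite mul1r mulN1r.
  have [aw _] := touched_ends aJ.
  have := crowded_const (u := fun F => sg F * u F) fE FJ aw; rewrite /= mul1r => <-.
  by rewrite mulrA; case: (F) => ?; rewrite /= ?mulrNN !mul1r.
pose u' F := u F - sg F * k.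
have u'sum : \sum_F u' F = \sum_F u F.
  rewrite sumrB [X in _ - X]big_sumType /= !sumr_const mul1r mulN1r mulNrn white_black.
  by rewrite subrr subr0.
have u'E F : u' F = \sum_(a in edges_at F) u' F *+ (a \in I :\: J).
  rewrite sumrMnr; have -> : (\sum_(a in edges_at F) (a \in I :\: J) = valence (I :\: J) F)%N.
    rewrite /valence -sum1_card big_mkcond [RHS]big_mkcond; apply: eq_bigr => a _.
    by rewrite in_setI andbC; case: (a \in edges_at F); case: (a \in I :\: J).
  have := valence_isolated F; case: (boolP (touched J F)) => [FJ|_].
    by rewrite /u' kE // subrr mul0rn.
  by rewrite addn0 => ->.
rewrite -u'sum big_sumType /=.
transitivity (\sum_a (u' (inl (white_of a)) + u' (inr (black_of a))) *+ (a \in I :\: J)).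
  under [RHS]eq_bigr do rewrite mulrnDl.
  rewrite [RHS]big_split; congr (_ + _); [rewrite -[RHS]big_white | rewrite -[RHS]big_black].
    apply: eq_bigr => w _; rewrite {1}u'E; apply: eq_bigr => a.
    by rewrite mem_edges_at => /eqP ->.
  apply: eq_bigr => w _; rewrite {1}u'E; apply: eq_bigr => a.
  by rewrite mem_edges_at => /eqP ->.
rewrite big1 // => a _; case: (boolP (a \in I :\: J)) => // /setDP[/u0 ua _].
by rewrite mulr1n /u' /= mul1r mulN1r addrACA ua opprK addNr addr0.
Qed.

Lemma rank_flow_excess a : a \in J ->
  (#|J| + 1 = \rank (flow_mx J) + 2 * touched_white J)%N.
Proof.
move=> aJ; have := rank_flow_connected aJ (fun f => @crowded_const _ f).
by rewrite card_touched touched_black_crowded addn1 mul2n addnn.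
Qed.

Lemma rank_flow_no_crowded : J = finset.set0 -> \rank (flow_mx J) = 0%N.
Proof.
move=> J0; apply/eqP; rewrite mxrank_eq0 -submx0; apply/rV_subP=> v.
move/sub_flow_mx => [vJ _]; rewrite submx0; apply/eqP/row_fun_eq => a.
by rewrite vJ ?J0 ?in_set0 // /row_fun mxE.
Qed.

Lemma excess_split (A : finType) (v : A -> vert G) (tot : nat) :
  (\sum_i valence J (v i) = 2 * (\sum_i touched J (v i)) + tot)%N ->
  (\sum_i (valence J (v i) - 2 * touched J (v i)) = tot)%N.
Proof.
move=> vE; rewrite sumnB => [|i _]; last exact: valence_ge2 crowded_saturated _.
by rewrite vE big_distrr /= addKn.
Qed.

Lemma valence_two : #|J| = (2 * touched_white J)%N ->
  forall F, touched J F -> valence J F = 2%N.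
Proof.
move=> J2 F FJ; apply/eqP; rewrite eqn_leq; apply/andP; split; last first.
  by have := valence_ge2 F crowded_saturated (subxx _); rewrite FJ.
have ex0 (A : finType) (v : A -> vert G) i :
    (\sum_i (valence J (v i) - 2 * touched J (v i)) = 0)%N -> touched J (v i) ->
    (valence J (v i) <= 2)%N.
  move/eqP; rewrite sum_nat_eq0 => /forallP/(_ i) /=.
  by rewrite subn_eq0 => + vJ; rewrite vJ.
case: F FJ => w wJ.
  by apply: (ex0 _ inl) => //; apply: excess_split; rewrite addn0 sum_valence_white J2.
apply: (ex0 _ inr) => //; apply: excess_split.
by rewrite addn0 sum_valence_black J2 -touched_black_crowded.
Qed.

Lemma excess_one_two_trivalent : #|J| = (2 * touched_white J + 1)%N -> two_trivalent J.
Proof.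
have ex1 (A : finType) (v : A -> vert G) :
    (\sum_i (valence J (v i) - 2 * touched J (v i)) = 1)%N ->
    exists2 i, valence J (v i) = 3%N & forall j, j != i -> (0 < valence J (v j))%N ->
      valence J (v j) = 2%N.
  move/eqP/sum_nat_eq1 => [i [_ i1 i0]].
  exists i => [|j ji vj]; first by move: i1; rewrite touched_valence; lia.
  have := i0 j ji isT; rewrite touched_valence vj.
  have := valence_ge2 (v j) crowded_saturated (subxx _).
  by rewrite touched_valence vj; lia.
move=> J3; have [|w w3 w2] := ex1 _ inl.
  by apply: excess_split; rewrite sum_valence_white J3.
have [|b b3 b2] := ex1 _ inr.
  by apply: excess_split; rewrite sum_valence_black J3 -touched_black_crowded.
exists w, b; split=> // -[w'|b'] w'w b'b F0; [apply: w2 | apply: b2] => //.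
  by apply/eqP => ww; apply: w'w; rewrite ww.
by apply/eqP => bb; apply: b'b; rewrite bb.
Qed.

Lemma two_trivalent_excess : two_trivalent J -> #|J| = (2 * touched_white J + 1)%N.
Proof.
move=> [w [b [w3 b3 rest]]]; rewrite -(sum_valence_white J) /touched_white.
rewrite (bigD1 w) //= [X in (2 * X + 1)%N](bigD1 w) //= w3 touched_valence w3.
rewrite (eq_bigr (fun i => 2 * touched J (inl i))%N) => [|i iw]; last first.
  rewrite touched_valence; case: ltnP => [i0|]; last by rewrite leqn0 => /eqP.
  by rewrite rest // => -[] // ii; rewrite ii eqxx in iw.
by rewrite -big_distrr /= mulnDr addnAC.
Qed.

Lemma is_cycle_excess : is_cycle J -> #|J| = (2 * touched_white J)%N.
Proof.
move=> [p [_ /andP[/allP pw _] /andP[wuniq _] es_uniq JE]].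
have -> : #|J| = (2 * size p)%N.
  by rewrite (eq_card JE) (card_uniqP es_uniq) size_cat !size_map mul2n addnn.
congr (2 * _)%N; rewrite -(size_map (fun u => white_of u.1)) -(card_uniqP wuniq) -sum1_card.
rewrite big_mkcond; apply: eq_bigr => w _.
suff -> : (w \in [seq white_of u.1 | u <- p]) = touched J (inl w) by case: touched.
apply/mapP/touchedP => [[u up ->]|[a]].
  by exists u.1; rewrite ?mem_edges_at // JE mem_cat map_f.
rewrite JE mem_cat mem_edges_at => /orP[]/mapP[u up ->] /eqP <-; exists u => //.
by rewrite (eqP (pw u up)).
Qed.

End Cosupport.

(** * Cycles in subgraphs with all valences 2 *)

Section Partner.
Variables (G : brane_tiling) (J : {set edge G}) (end_of : edge G -> vert G).
Implicit Types a b : edge G.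
Hypothesis mem_end : forall a b, (b \in edges_at (end_of a)) = (end_of b == end_of a).
Hypothesis valence2 : forall F, touched J F -> valence J F = 2%N.

(** The other edge of [J] at the chosen end of [a]. The default [a] outside [J] makes this an
    involution of all edges. *)
Definition partner a :=
  odflt a [pick b | [&& a \in J, b \in J, b != a & b \in edges_at (end_of a)]].

Lemma partnerP a : a \in J ->
  [/\ partner a \in J, partner a != a, end_of (partner a) = end_of a &
      forall b, b \in J -> end_of b = end_of a -> b = a \/ b = partner a].
Proof.
move=> aJ; have aE : a \in J :&: edges_at (end_of a) by rewrite in_setI aJ mem_end eqxx.
have := valence2 (F := end_of a); case: touchedP => [_ /(_ isT)|[]]; last first.
  by exists a => //; rewrite mem_end.
rewrite /valence => J2; have [c cE] : exists c, J :&: edges_at (end_of a) :\ a = [set c].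
  by apply/cards1P; have := cardsD1 a (J :&: edges_at (end_of a)); rewrite J2 aE add1n => -[<-].
have inE' b : b \in J -> end_of b = end_of a -> b != a -> b = c.
  move=> bJ ba nba; apply/set1P; rewrite -cE in_setD1 nba in_setI bJ mem_end ba /=.
  exact: eqxx.
have /setD1P[ca /setIP[cJ cF]] : c \in J :&: edges_at (end_of a) :\ a by rewrite cE set11.
rewrite /partner; case: pickP => [b /and4P[_ bJ ba] /=|/(_ c)]; last first.
  by rewrite aJ cJ ca cF.
rewrite mem_end => /eqP bE; split=> // d dJ dE.
have [->|da] := eqVneq d a; [by left | right].
by rewrite (inE' d) // (inE' b).
Qed.

Lemma partner_out a : a \notin J -> partner a = a.
Proof. by rewrite /partner => /negPf aJ; case: pickP => // b; rewrite aJ. Qed.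

Lemma partnerK : involutive partner.
Proof.
move=> a; have [aJ|aJ] := boolP (a \in J); last by rewrite !partner_out.
have [pJ pa pE _] := partnerP aJ; have [ppJ ppp ppE _] := partnerP pJ.
have [_ _ _ only] := partnerP aJ.
have [//|ppa] := only _ ppJ (etrans ppE pE); by rewrite ppa eqxx in ppp.
Qed.

Lemma flow_partner (f : edge G -> rat) a : flow f -> (forall b, b \notin J -> f b = 0) ->
  a \in J -> f (partner a) = - f a.
Proof.
move=> fflow fJ aJ; have [pJ pa pE only] := partnerP aJ; apply/eqP.
rewrite -addr_eq0 addrC -(fflow (end_of a)) /vertex_sum.
rewrite (bigD1 a) ?mem_end //= (bigD1 (partner a)) ?mem_end ?pE ?eqxx //=.
rewrite big1 ?addr0 // => b /andP[/andP[bE ba] bp].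
have [bJ|/fJ //] := boolP (b \in J); move: bE; rewrite mem_end => /eqP bE.
by have [bb|bb] := only b bJ bE; [rewrite bb eqxx in ba | rewrite bb eqxx in bp].
Qed.

End Partner.

Section CycleConstruction.
Variables (G : brane_tiling) (I J : {set edge G}).
Hypothesis JI : J \subset I.
Hypothesis J_saturated : saturated I J.
Hypothesis J_connected : forall a b, a \in J -> b \in J -> connect (adjacent I) a b.
Hypothesis valence2 : forall F, touched J F -> valence J F = 2%N.

(** Passing alternately to the white and the black partner walks around [J]. The flow changes sign
    at every passage, so its sign separates the edges [e_i] of the walk from the [f_i] and excludes
    repetitions; connectedness of [J] shows that the walk meets every edge. *)
Lemma valence_two_is_cycle (f : edge G -> rat) a0 : flow f ->
  (forall b, b \notin J -> f b = 0) -> f a0 != 0 -> is_cycle J.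
Proof.
move=> fflow fJ fa0.
have mem_w a b : (b \in edges_at (inl (white_of a))) = (inl (white_of b) == inl (white_of a) :> vert G).
  by rewrite mem_edges_at.
have mem_b a b : (b \in edges_at (inr (black_of a))) = (inr (black_of b) == inr (black_of a) :> vert G).
  by rewrite mem_edges_at.
have inlI (w w' : white G) : inl w = inl w' :> vert G -> w = w' by case.
have inrI (w w' : black G) : inr w = inr w' :> vert G -> w = w' by case.
pose pw := partner J (fun a => inl (white_of a) : vert G).
pose pb := partner J (fun a => inr (black_of a) : vert G).
have pwP := partnerP mem_w valence2; have pbP := partnerP mem_b valence2.
rewrite -/pw in pwP; rewrite -/pb in pbP.
have pwK : involutive pw := partnerK mem_w valence2.
have pbK : involutive pb := partnerK mem_b valence2.
have pwf a : a \in J -> f (pw a) = - f a := flow_partner mem_w valence2 fflow fJ (a := a).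
have pbf a : a \in J -> f (pb a) = - f a := flow_partner mem_b valence2 fflow fJ (a := a).
have a0J : a0 \in J by apply: contraNT fa0 => /fJ ->.
pose step a := pb (pw a); pose o := fingraph.orbit step a0.
have step_inj : injective step by apply: inj_comp (inv_inj pbK) (inv_inj pwK).
have stepJ a : a \in J -> step a \in J.
  by move=> aJ; have [pJ _ _ _] := pwP a aJ; have [] := pbP _ pJ.
have oP a : a \in o -> a \in J /\ f a = f a0.
  rewrite -fconnect_orbit => /iter_findex <-; elim: (findex _ _ _) => // n [IHJ IHf].
  have [pJ _ _ _] := pwP _ IHJ; split; first exact: stepJ.
  by rewrite iterS pbf // pwf // opprK.
have fN (c : rat) : c = f a0 -> c = - f a0 -> False.
  move=> -> /eqP; rewrite -subr_eq0 opprK -mulr2n mulrn_eq0 /= => fa00.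
  by rewrite fa00 in fa0.
pose p := [seq (a, pw a) | a <- o].
have p1 : [seq u.1 | u <- p] = o by rewrite -map_comp map_id.
have p2 : [seq u.2 | u <- p] = [seq pw a | a <- o] by rewrite -map_comp.
have disj a b : a \in o -> b \in o -> a <> pw b.
  move=> ao bo ab; have [aJ fa] := oP a ao; have [bJ fb] := oP b bo.
  by apply: (fN (f a)) => //; rewrite ab pwf // fb.
exists p; split.
- by rewrite -size_eq0 size_map /o fingraph.size_orbit -lt0n fingraph.order_gt0.
- apply/andP; split.
    apply/allP=> u /mapP[a ao ->] /=; have [aJ _] := oP a ao.
    by have [_ _ /inlI -> _] := pwP a aJ.
  rewrite cycle_map; apply: (@sub_in_cycle _ (mem J) (frel step)) (cycle_orbit step_inj a0).
    move=> a b aJ _ /= /eqP <-; have [pJ _ _ _] := pwP a aJ.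
    by have [_ _ /inrI -> _] := pbP _ pJ.
  by apply/allP=> a /oP[].
- apply/andP; split; rewrite -map_comp map_inj_in_uniq ?fingraph.orbit_uniq // => a b ao bo /= ab.
    have [[aJ _] [bJ _]] := (oP a ao, oP b bo).
    have [_ _ _ only] := pwP a aJ; have [|//|bp] := only b bJ; first by rewrite ab.
    by case: (disj b a bo ao).
  have [[aJ fa] [bJ fb]] := (oP a ao, oP b bo).
  have [paJ _ _ _] := pwP a aJ; have [pbJ _ _ _] := pwP b bJ.
  have [_ _ _ only] := pbP _ paJ; have [||pp] := only _ pbJ; first by rewrite ab.
    by move/(inv_inj pwK).
  case: (fN (f (pw b))); last by rewrite pwf // fb.
  by rewrite pp pbf // pwf // opprK.
- rewrite p1 p2 cat_uniq fingraph.orbit_uniq map_inj_uniq ?fingraph.orbit_uniq ?andbT /=.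
    by apply/hasPn => _ /mapP[b bo ->]; apply/negP => /disj/(_ bo).
  exact: inv_inj.
rewrite p1 p2; have esJ a : a \in o ++ [seq pw a | a <- o] -> a \in J.
  rewrite mem_cat => /orP[/oP[]//|/mapP[b /oP[bJ _] ->]].
  by have [] := pwP b bJ.
have es_w a : a \in o ++ [seq pw a | a <- o] -> pw a \in o ++ [seq pw a | a <- o].
  rewrite !mem_cat => /orP[ao|/mapP[b bo ->]]; first by rewrite map_f ?orbT.
  by rewrite pwK bo.
have o_step a : (step a \in o) = (a \in o).
  rewrite -!fconnect_orbit; apply/idP/idP => [h|/connect_trans]; last first.
    by apply; apply: fconnect1.
  apply: connect_trans h _; rewrite fconnect_sym //; exact: fconnect1.
have es_b a : a \in o ++ [seq pw a | a <- o] -> pb a \in o ++ [seq pw a | a <- o].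
  rewrite !mem_cat => /orP[ao|/mapP[b bo ->]]; last by rewrite -/(step b) o_step bo.
  apply/orP; right; apply/mapP; exists (pw (pb a)); last by rewrite pwK.
  by rewrite -o_step /step pwK pbK.
move=> a; apply/idP/idP => [aJ|/esJ //].
(* The edges of the walk are closed under both partners, hence saturated, and connectedness gives
   all of [J]. *)
pose K := finset (mem (o ++ [seq pw a | a <- o])).
have KE b : (b \in K) = (b \in o ++ [seq pw a | a <- o]) by rewrite in_set.
have Ksat : saturated I K.
  move=> b c F; rewrite !KE => bK cI bF cF; have bJ := esJ b bK.
  have cJ := J_saturated bJ cI bF cF.
  case: F bF cF => w; rewrite !mem_edges_at => /eqP <- /eqP cw.
    have [_ _ _ only] := pwP b bJ; have [|->//|->] := only c cJ; first by rewrite cw.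
    exact: es_w.
  have [_ _ _ only] := pbP b bJ; have [|->//|->] := only c cJ; first by rewrite cw.
  exact: es_b.
rewrite -KE; apply: connect_adjacent_sub Ksat _ _ (J_connected a0J aJ).
  by apply/subsetP=> b; rewrite KE => /esJ/(subsetP JI).
by rewrite KE mem_cat /o -fconnect_orbit connect0.
Qed.

End CycleConstruction.

(** * Cosupports of representations and the four cases *)

Section CosupportOfModule.
Variables (R : realType) (G : brane_tiling).
Variable x : {ffun edge G -> R[i]}.
Hypothesis x_rel : satisfies_relations x.
Local Notation I := (cosupport x).

Lemma mem_cosupport a : (a \in I) = (x a == 0).
Proof. by rewrite inE. Qed.

Lemma prod_eq0_at a (F : vert G) : (\prod_(b in edges_at F | b != a) x b == 0) =
  [exists b, [&& b \in I, b != a & b \in edges_at F]].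
Proof.
rewrite prodf_seq_eq0; apply/hasP/existsP => [[b _ /andP[/andP[bF ba] xb]]|[b /and3P[bI ba bF]]].
  by exists b; rewrite mem_cosupport xb ba bF.
by exists b; rewrite ?mem_index_enum // bF ba -mem_cosupport.
Qed.

(** By the relation of [a], the products of the remaining arrows at its two ends vanish together. *)
Lemma cosupport_crowded_vertex a F : a \in crowded I -> a \in edges_at F ->
  exists b, [/\ b \in I, b != a & b \in edges_at F].
Proof.
move=> /crowdedP[aI [b [F' [bI ba aF' bF']]]] aF.
have eq0 F1 F2 : a \in edges_at F1 -> a \in edges_at F2 ->
    (\prod_(b in edges_at F1 | b != a) x b == 0) = (\prod_(b in edges_at F2 | b != a) x b == 0).
  have := (satisfies_relationsP x).1 x_rel a.
  by rewrite !mem_edges_at; case: F1 => w1; case: F2 => w2 rel /eqP <- /eqP <-; rewrite ?rel.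
have := eq0 _ _ aF' aF; rewrite !prod_eq0_at => e.
have /existsP[c /and3P[cI ca cF]] : [exists b, [&& b \in I, b != a & b \in edges_at F]].
  by rewrite -e; apply/existsP; exists b; rewrite bI ba.
by exists c.
Qed.

(** Multiplied by [x b], the relation of [b] equates the full products at its two ends; by
    connectedness the full products are equal at all vertices, and one of them vanishes. *)
Lemma cosupport_covers a F : a \in I -> touched I F.
Proof.
move=> aI; pose u F : R[i] := \prod_(b in edges_at F) x b.
have uE b : u (inl (white_of b)) = u (inr (black_of b)).
  have uF F1 : b \in edges_at F1 -> u F1 = x b * \prod_(c in edges_at F1 | c != b) x c.
    by move=> bF; rewrite /u (bigD1 b).
  by rewrite !uF ?mem_edges_at // ((satisfies_relationsP x).1 x_rel b).
have : u F = 0.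
  rewrite (vert_const uE F (inl (white_of a))); apply/eqP.
  move: aI; rewrite mem_cosupport => /eqP xa.
  by rewrite /u (bigD1 a) ?mem_edges_at //= xa mul0r.
move/eqP; rewrite /u prodf_seq_eq0 => /hasP[b _ /andP[bF xb]].
by apply/touchedP; exists b; rewrite ?mem_cosupport.
Qed.

End CosupportOfModule.

Theorem proposition4p15 (R : realType) (G : brane_tiling)
    (HG : geometrically_consistent G R)
    (theta : {ffun Q0 G -> int}) (HB : in_B theta) (Hgen : generic theta)
    (x : {ffun edge G -> R[i]}) (Hx : semistable theta x) :
  [/\ T_M_orbit_dim theta x 3 <-> cosupport x = set0,
      T_M_orbit_dim theta x 2 <-> perfect_matching (cosupport x),
      T_M_orbit_dim theta x 1 <->
        (exists C, unique (big_component (cosupport x)) C /\ is_cycle C) &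
      T_M_orbit_dim theta x 0 <->
        (exists C, unique (big_component (cosupport x)) C /\ two_trivalent C)].
Proof.
have [a0 _] := some_edge G; pose F0 : vert G := inl (white_of a0).
have [e edim eE] := orbit_dim_cosupport F0 HG HB Hgen Hx.
have dimE n : T_M_orbit_dim theta x n = (n = e).
  apply: propext; split=> [[nchain nmax]|->//]; have [echain emax] := edim.
  by apply/eqP; rewrite eqn_leq emax // nmax.
set I := cosupport x in eE *; rewrite !dimE {dimE}.
have x_rel : satisfies_relations x by case: Hx.
(* The cases are exclusive: [e] is 3 for empty [I], 2 if [I] is nonempty without crowded edges, and
   at most 1 otherwise. This yields both directions of each equivalence. *)
have [I0|/set0Pn[b0 b0I]] := eqVneq I set0.
  have e3 : e = 3.
    have := mxrankS (capmxSr (balanced_mx F0) (support_mx (mem I))).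
    by rewrite rank_support_mx [#|_|]eq_card0 => [|a]; [lia | rewrite I0 inE].
  have nobig C : ~ big_component I C by case=> -[a]; rewrite I0 inE.
  rewrite e3; split; split=> //.
  - by move/(_ F0); rewrite I0 set0I cards0.
  - by case=> C [[/nobig]].
  - by case=> C [[/nobig]].
have cv := @cosupport_crowded_vertex R G x x_rel; have cov F := cosupport_covers x_rel F b0I.
have Iconn (h : Q0 G -> rat) : (forall a, a \notin I -> h (src a) = h (tgt a)) ->
    forall i j, h i = h j.
  move=> hE; apply: (support_connected HB Hgen Hx) => a xa; apply: hE.
  by rewrite mem_cosupport.
have wb := card_white_black HG.
have bigP := big_componentP cv Iconn.
move: eE; rewrite (rank_balanced_support cv cov Iconn wb F0).
have IN0 : I <> set0 by move=> I0; rewrite I0 inE in b0I.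
have [J0|/set0Pn[a aJ]] := eqVneq (crowded I) set0.
  rewrite rank_flow_no_crowded // addn1 => -[->].
  have nobig C : ~ big_component I C by move/bigP; rewrite J0 eqxx; case.
  split; split=> //.
  - move=> _ F; have := valence_isolated cov F; rewrite J0 setD0 /touched set0I eqxx addn0.
    by [].
  - by case=> C [[/nobig]].
  - by case=> C [[/nobig]].
have bigJ : unique (big_component I) (crowded I).
  have JN0 : crowded I != set0 by apply/set0Pn; exists a.
  by split=> [|C /bigP[]//]; apply/bigP.
have exJ (P : {set edge G} -> Prop) :
    (exists C, unique (big_component I) C /\ P C) = P (crowded I).
  apply: propext; split=> [[C [[Cbig _]]]|PJ]; last by exists (crowded I).
  by have [_ ->] := (bigP C).1 Cbig.
rewrite !exJ.
have excess := rank_flow_excess cv cov Iconn wb aJ; rewrite -/I in excess.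
have ge2 : (2 * touched_white (crowded I) <= #|crowded I|)%N.
  rewrite -(sum_valence_white (crowded I)) /touched_white big_distrr /=.
  by apply: leq_sum => w _; apply: (valence_ge2 cv) => //; apply: crowded_saturated.
have cyc : is_cycle (crowded I) = (#|crowded I| = 2 * touched_white (crowded I))%N.
  apply: propext; split=> [|J2]; first exact: is_cycle_excess.
  have [f [fJ fflow [b fb]]] := flow_exists cv (@crowded_saturated _ I) (subxx _) aJ.
  apply: (valence_two_is_cycle (crowded_sub I) _ _ _ fflow fJ fb).
  - exact: crowded_saturated.
  - exact: crowded_connected.
  - exact: (valence_two cv cov wb J2).
have tri : two_trivalent (crowded I) = (#|crowded I| = 2 * touched_white (crowded I) + 1)%N.
  apply: propext; split=> [|J3]; first exact: two_trivalent_excess.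
  exact: (excess_one_two_trivalent cv cov wb J3).
rewrite cyc tri.
(* What remains is arithmetic, up to two exclusions: [e + r + 1 = 3], the excess formula and [ge2]
   leave [r = 1], where all valences are 2, and [r = 2], where the excess is 1. *)
have [r rE] : exists r : nat, \rank (flow_mx (crowded I)) = r by eexists.
rewrite rE => eE; rewrite rE in excess.
split; split; try lia.
- by move/IN0.
- move=> pm; exfalso.
  have aF : a \in edges_at (inl (white_of a)) by rewrite mem_edges_at.
  have [b [bI ba bF]] := cv a _ aJ aF; have := pm (inl (white_of a)).
  apply/eqP; rewrite gtn_eqF //; apply/card_gt1P; exists a, b.
  by split; rewrite ?in_setI ?bI ?bF ?(subsetP (crowded_sub I) _ aJ) // eq_sym.
Qed.
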